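(* Let $1\le p<\infty$. The unweighted bilateral shift $B$ on $\ell_p(\mathbb{Z})$, defined on the canonical basis by $Be_n=e_{n-1}$ for $n\in\mathbb{Z}$, is weakly supercyclic if and only if $p>2$.
   Context: $\ell_p(\mathbb{Z})$ is the complex Banach space with canonical basis $\{e_n\}_{n\in\mathbb{Z}}$. A bounded linear operator $T$ on a complex Banach space $\mathcal{B}$ is weakly supercyclic if there exists $x\in\mathcal{B}$ such that $\{\lambda T^nx:n=0,1,2,\dots,\ \lambda\in\mathbb{C}\}$ is dense in $\mathcal{B}$ in the weak topology. *)

(* Defs.v *)
From HB Require Import structures.
From mathcomp Require Import all_boot all_order all_algebra finmap.
From mathcomp Require Import complex.
From mathcomp Require Import all_classical all_reals all_analysis.
From mathcomp Require Import lra ring.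
Import Order.TTheory GRing.Theory Num.Theory.
Import numFieldNormedType.Exports.
Import Normc.

Set Implicit Arguments.
Unset Strict Implicit.
Unset Printing Implicit Defensive.

Local Open Scope classical_set_scope.
Local Open Scope ring_scope.
Local Open Scope complex_scope.

Section lp_sum.
Context {R : realType} (p : R).
Implicit Types (x y : int -> R[i]) (A : {fset int}).

Definition lp_sum x : \bar R :=
  (\esum_(n in [set: int]) (normc (x n) `^ p)%:E)%E.

Definition lp_norm x : R := fine (lp_sum x) `^ p^-1.

Hypothesis p1 : 1 <= p.
Let p0 : 0 < p. Proof. exact: lt_le_trans p1. Qed.

Lemma normc_ge0 (z : R[i]) : 0 <= normc z.
Proof. by case: z => a b; exact: sqrtr_ge0. Qed.

Lemma lp_sum_ge0 x : (0 <= lp_sum x)%E.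
Proof. by apply: esum_ge0 => n _; rewrite lee_fin powR_ge0. Qed.

Lemma lp_sum_le x (M : R) :
  (lp_sum x <= M%:E)%E <-> forall A, \sum_(i <- A) normc (x i) `^ p <= M.
Proof.
split=> [le_xM A|le_xM].
  rewrite -lee_fin; apply: le_trans le_xM; apply: ereal_sup_ubound.
  exists [set` A]; first by split=> //; exact: finite_fset.
  by rewrite fsbig_finite ?set_fsetK ?sumEFin //; exact: finite_fset.
apply: ge_ereal_sup => _ [A [finA _] <-].
by rewrite fsbig_finite //= sumEFin lee_fin.
Qed.

Lemma lp_norm_ge0 x : 0 <= lp_norm x. Proof. exact: powR_ge0. Qed.

Lemma lp_normP x (M : R) : 0 <= M -> (lp_sum x < +oo)%E ->
  lp_norm x <= M <-> forall A, \sum_(i <- A) normc (x i) `^ p <= M `^ p.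
Proof.
move=> M0 finx.
have finx' : lp_sum x \is a fin_num by rewrite ge0_fin_numE // lp_sum_ge0.
have sx0 : 0 <= fine (lp_sum x) by rewrite fine_ge0 // lp_sum_ge0.
have sxE : lp_norm x `^ p = fine (lp_sum x).
  by rewrite -powRrM mulVf ?gt_eqF // powRr1.
apply: iff_trans (lp_sum_le _ _); rewrite -(fineK finx') lee_fin -sxE.
split=> [le_xM|].
  by apply: ge0_ler_powR; rewrite ?nnegrE ?lp_norm_ge0 // ltW.
rewrite !leNgt; apply: contra => lt_Mx.
by apply: gt0_ltr_powR; rewrite ?nnegrE ?lp_norm_ge0.
Qed.

Lemma lp_sum_fin x (M : R) :
  (forall A, \sum_(i <- A) normc (x i) `^ p <= M) -> (lp_sum x < +oo)%E.
Proof. by move=> /lp_sum_le /le_lt_trans; apply; rewrite ltry. Qed.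

Lemma minkowski_fin x y A (s t : R) : 0 < s -> 0 < t ->
  \sum_(i <- A) normc (x i) `^ p <= s `^ p ->
  \sum_(i <- A) normc (y i) `^ p <= t `^ p ->
  \sum_(i <- A) normc (x i + y i) `^ p <= (s + t) `^ p.
Proof.
move=> s0 t0 les let_.
have st0 : 0 < s + t by exact: addr_gt0.
pose w := s / (s + t).
have w0 : 0 <= w by rewrite divr_ge0 // ltW.
have w1 : w <= 1 by rewrite ler_pdivrMr // mul1r lerDl ltW.
have pt u v : 0 <= u -> 0 <= v ->
    (u + v) `^ p <= (s + t) `^ p * (w * (u / s) `^ p + (1 - w) * (v / t) `^ p).
  move=> u0 v0.
  have : (w * (u / s) + (1 - w) * (v / t)) `^ p <=
      w * (u / s) `^ p + (1 - w) * (v / t) `^ p.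
    have := @convex_powR R p p1 (Itv01 w0 w1) (u / s) (v / t).
    rewrite !inE /= !in_itv /= !andbT !divr_ge0 ?(ltW s0) ?(ltW t0) //.
    move=> /(_ isT isT) le_c; rewrite [X in X `^ _ <= _]convRE in le_c.
    by rewrite [leRHS]convRE in le_c.
  move=> le_c.
  have -> : u + v = (s + t) * (w * (u / s) + (1 - w) * (v / t)).
    by rewrite /w; field; rewrite !gt_eqF.
  rewrite powRM ?(ltW st0) //; last first.
    by rewrite addr_ge0 // mulr_ge0 ?subr_ge0 // divr_ge0 // ltW.
  by rewrite ler_wpM2l ?powR_ge0.
have powRV (a : R) : 0 < a -> (a^-1) `^ p = (a `^ p)^-1.
  by move=> a0; rewrite -powR_inv1 ?ltW // -powRrM mulN1r powRN.
have bnd z (a : R) : 0 < a -> \sum_(i <- A) normc (z i) `^ p <= a `^ p ->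
    \sum_(i <- A) (normc (z i) / a) `^ p <= 1.
  move=> a0 le_a.
  rewrite (eq_bigr (fun i => normc (z i) `^ p * (a `^ p)^-1)); last first.
    by move=> i _; rewrite powRM ?normc_ge0 ?invr_ge0 ?(ltW a0) // powRV.
  by rewrite -mulr_suml ler_pdivrMr ?mul1r // powR_gt0.
apply: (@le_trans _ _ (\sum_(i <- A) (s + t) `^ p *
  (w * (normc (x i) / s) `^ p + (1 - w) * (normc (y i) / t) `^ p))).
  apply: ler_sum => i _; apply: le_trans (pt _ _ (normc_ge0 _) (normc_ge0 _)).
  apply: ge0_ler_powR; rewrite ?nnegrE ?addr_ge0 ?normc_ge0 ?(ltW p0) //.
  exact: le_normcD.
rewrite -mulr_sumr -[leRHS]mulr1 ler_wpM2l ?powR_ge0 //.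
rewrite big_split /= -!mulr_sumr -[leRHS](subrK w) addrC.
by rewrite lerD // -[leRHS]mulr1 ler_wpM2l ?subr_ge0 ?bnd.
Qed.

Lemma lp_sumD_norm x y : (lp_sum x < +oo)%E -> (lp_sum y < +oo)%E ->
  (lp_sum (fun n => x n + y n)%R < +oo)%E /\
  lp_norm (fun n => x n + y n) <= lp_norm x + lp_norm y.
Proof.
move=> finx finy.
have bnd e : 0 < e -> forall A, \sum_(i <- A) normc (x i + y i) `^ p <=
    (lp_norm x + e + (lp_norm y + e)) `^ p.
  move=> e0 A; apply: minkowski_fin; rewrite ?ltr_wpDl ?lp_norm_ge0 //.
  - by apply: (lp_normP _ finx).1; rewrite ?addr_ge0 ?lp_norm_ge0 ?lerDl ?(ltW e0).
  - by apply: (lp_normP _ finy).1; rewrite ?addr_ge0 ?lp_norm_ge0 ?lerDl ?(ltW e0).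
have fin : (lp_sum (fun n => x n + y n)%R < +oo)%E.
  exact: lp_sum_fin (bnd 1 ltr01).
split=> //; apply/ler_addgt0Pr => e e0.
have e20 : 0 < e / 2 by rewrite divr_gt0.
pose M := lp_norm x + e / 2 + (lp_norm y + e / 2).
have -> : lp_norm x + lp_norm y + e = M by rewrite /M addrACA -splitr.
have M0 : 0 <= M by do 2 !apply: addr_ge0; rewrite ?lp_norm_ge0 // ltW.
exact: (lp_normP M0 fin).2 (bnd _ e20).
Qed.

Lemma lp_sumZ_norm (a : R[i]) x : (lp_sum x < +oo)%E ->
  (lp_sum (fun n => a * x n)%R < +oo)%E /\
  lp_norm (fun n => a * x n) <= normc a * lp_norm x.
Proof.
move=> finx.
have bnd A : \sum_(i <- A) normc (a * x i) `^ p <= (normc a * lp_norm x) `^ p.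
  rewrite (eq_bigr (fun i => normc a `^ p * normc (x i) `^ p)); last first.
    by move=> i _; rewrite normcM powRM ?normc_ge0.
  rewrite -mulr_sumr powRM ?normc_ge0 ?lp_norm_ge0 //.
  by rewrite ler_wpM2l ?powR_ge0 //; apply: (lp_normP _ finx).1; rewrite ?lp_norm_ge0.
have fin := lp_sum_fin bnd; split=> //.
by apply: (lp_normP _ fin).2; rewrite ?mulr_ge0 ?normc_ge0 ?lp_norm_ge0.
Qed.

Lemma lp_sum0 : (lp_sum (fun=> 0)%R < +oo)%E.
Proof.
by apply: (@lp_sum_fin _ 0) => A; rewrite big1 // => i _; rewrite normc0 powR0 ?gt_eqF.
Qed.

Lemma normc_le_lp_norm x n : (lp_sum x < +oo)%E -> normc (x n) <= lp_norm x.
Proof.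
move=> finx; rewrite leNgt; apply/negP => lt_nx.
have /(lp_normP (lp_norm_ge0 x) finx)/(_ [fset n]%fset) := lexx (lp_norm x).
rewrite big_seq_fset1 leNgt gt0_ltr_powR ?nnegrE ?lp_norm_ge0 ?normc_ge0 //.
Qed.

End lp_sum.

Section lp_space.
Context {R : realType} {p : R} (p1 : 1 <= p).

(* The proof p1 is a dummy argument, so that the closure properties of lp_fun,
   which need it, can be found by canonical inference. *)
Definition lp_fun : {pred int -> R[i]^o} :=
  let _ := p1 in mem [set x : int -> R[i]^o | (lp_sum p x < +oo)%E].

Record lp : Type := Lp { lp_val :> int -> R[i]^o; _ : lp_val \in lp_fun }.
HB.instance Definition _ := [isSub for lp_val].
HB.instance Definition _ := [Choice of lp by <:].

Lemma lp_valP (x : lp) : (lp_sum p x < +oo)%E.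
Proof. by case: x => x /= /[!inE]. Qed.

Lemma lp_funP (x : int -> R[i]^o) : (lp_sum p x < +oo)%E -> x \in lp_fun.
Proof. by rewrite inE. Qed.

Lemma lp_submod_closed : submod_closed lp_fun.
Proof.
split=> [|a x y]; rewrite !inE /=; first exact: lp_sum0.
by move=> finx finy; apply: (lp_sumD_norm p1 (lp_sumZ_norm p1 a finx).1 finy).1.
Qed.

HB.instance Definition _ :=
  GRing.isSubmodClosed.Build _ _ lp_fun lp_submod_closed.
HB.instance Definition _ := [SubChoice_isSubLmodule of lp by <:].

Let nm (x : lp) : R[i] := (lp_norm p x)%:C.

Let nmD (x y : lp) : nm (x + y) <= nm x + nm y.
Proof.
rewrite /nm -rmorphD /= lecR.
exact: (lp_sumD_norm p1 (lp_valP x) (lp_valP y)).2.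
Qed.

Let nmZ_le (a : R[i]) (x : lp) : lp_norm p (a *: x) <= normc a * lp_norm p x.
Proof. exact: (lp_sumZ_norm p1 a (lp_valP x)).2. Qed.

Let nmZ (a : R[i]) (x : lp) : nm (a *: x) = `|a| * nm x.
Proof.
rewrite /nm (_ : `|a| = (normc a)%:C) // -rmorphM /=; congr (_%:C); apply/eqP.
rewrite eq_le nmZ_le /=; have [->|a0] := eqVneq a 0.
  by rewrite normc0 mul0r lp_norm_ge0.
have na0 : 0 < normc a.
  by rewrite lt_def normc_ge0 andbT; apply: contra_neq a0; exact: eq0_normc.
rewrite -ler_pdivlMl // -normcV.
by rewrite -{1}[x](scalerK a0); exact: nmZ_le.
Qed.

Let nm0_eq0 (x : lp) : nm x = 0 -> x = 0.
Proof.
case=> nx0; apply/val_inj/funext => n /=; apply: eq0_normc; apply/eqP.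
by rewrite eq_le normc_ge0 -nx0 normc_le_lp_norm ?lp_valP.
Qed.

HB.instance Definition _ := Lmodule_isNormed.Build R[i] lp nmD nmZ nm0_eq0.

Lemma lp_normE (x : lp) : `|x| = (lp_norm p x)%:C.
Proof. by []. Qed.

Lemma lp_ballE (x y : lp) (e : R) : ball x e%:C y <-> lp_norm p (x - y)%R < e.
Proof. by rewrite -ball_normE /= lp_normE ltcR. Qed.

Let coord_cauchy (F : set_system lp) (f : R[i] -> R) n :
  (forall u v, f u - f v = f (u - v)) -> (forall u, `|f u| <= normc u) ->
  ProperFilter F -> cauchy F -> cvg ((fun x : lp => f (x n)) @ F).
Proof.
move=> fB f_le FF /cauchy_ballP Fc; apply: cauchy_cvg; apply/cauchy_ballP => e e0.
have eC0 : 0 < e%:C by rewrite ltcR.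
have [[P Q] [/= FP FQ] PQ] := Fc _ eC0.
exists ((fun x : lp => f (x n)) @` P, (fun x : lp => f (x n)) @` Q) => /=.
  by split; [apply: filterS FP|apply: filterS FQ] => x ?; exists x.
move=> [_ _] /= [[x Px <-] [y Qy <-]].
have /lp_ballE xy : ball x e%:C y by exact: (PQ (x, y)).
rewrite /ball /= fB; apply: le_lt_trans xy; apply: le_trans (f_le _) _.
exact: (normc_le_lp_norm p1 n (lp_valP (x - y))).
Qed.

Lemma lp_complete (F : set_system lp) : ProperFilter F -> cauchy F -> cvg F.
Proof.
move=> FF Fc.
have ReB (u v : R[i]) : complex.Re u - complex.Re v = complex.Re (u - v) by rewrite raddfB.
have ImB (u v : R[i]) : complex.Im u - complex.Im v = complex.Im (u - v) by rewrite raddfB.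
have Re_le (u : R[i]) : `|complex.Re u| <= normc u.
  by case: u => a b; rewrite -sqrtr_sqr ler_wsqrtr // lerDl sqr_ge0.
have Im_le (u : R[i]) : `|complex.Im u| <= normc u.
  by case: u => a b; rewrite -sqrtr_sqr ler_wsqrtr // lerDr sqr_ge0.
pose lr n := lim ((fun x : lp => complex.Re (x n)) @ F).
pose li n := lim ((fun x : lp => complex.Im (x n)) @ F).
pose l n : R[i] := lr n +i* li n.
have Fl n (e : R) : 0 < e -> F [set x : lp | normc (x n - l n) < e].
  move=> e0; have e20 : 0 < e / 2 by rewrite divr_gt0.
  have /cvgrPdist_lt/(_ _ e20) cRe := @coord_cauchy F _ n ReB Re_le FF Fc.
  have /cvgrPdist_lt/(_ _ e20) cIm := @coord_cauchy F _ n ImB Im_le FF Fc.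
  apply: filterS2 cRe cIm => x /=; rewrite -/(lr n) -/(li n) /l.
  case: (x n) => a b /= lRe lIm.
  rewrite -[_ < e]/(normc ((a - lr n) +i* (b - li n)) < e).
  rewrite (_ : _ +i* _ = (a - lr n)%:C + (b - li n)*i); last by simpc.
  apply: le_lt_trans (le_normcD _ _) _; rewrite /= !expr0n /= addr0 add0r.
  by rewrite !sqrtr_sqr (splitr e) ltrD // distrC.
have bnd (e : R) : 0 < e -> F [set x : lp |
    forall A : {fset int}, \sum_(i <- A) normc (x i - l i) `^ p <= (e + e) `^ p].
  move=> e0; have eC0 : 0 < e%:C by rewrite ltcR.
  have /cauchy_ballP/(_ _ eC0)[[P Q] [/= FP FQ] PQ] := Fc.
  apply: filterS FP => x Px A.
  pose d := (e `^ p / #|`A|.+1%:R) `^ p^-1.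
  have q0 : 0 < e `^ p / #|`A|.+1%:R by rewrite divr_gt0 ?powR_gt0.
  have d0 : 0 < d by rewrite powR_gt0.
  have FA : F [set y : lp | forall i, i \in A -> normc (y i - l i) < d].
    have : F (\bigcap_(i in [set` A]) [set y : lp | normc (y i - l i) < d]).
      by apply: filter_bigI => i _; exact: Fl.
    by apply: filterS => y Ay i iA; exact: Ay i iA.
  have [y [Qy yA]] := filter_ex (filterI FQ FA).
  have := @minkowski_fin R p p1 (fun i => (x - y) i) (fun i => y i - l i) A e e e0 e0.
  rewrite [X in _ -> _ -> X <= _](eq_bigr (fun i => normc (x i - l i) `^ p));
    last by move=> i _; congr (normc _ `^ p); exact: (@subrKA R[i] (y i) (x i) (- l i)).
  apply.
    apply: (lp_normP p1 (ltW e0) (lp_valP (x - y))).1.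
    by apply/ltW/lp_ballE/(PQ (x, y)).
  apply: (@le_trans _ _ (\sum_(i <- A) e `^ p / #|`A|.+1%:R)).
    rewrite big_seq [leRHS]big_seq; apply: ler_sum => i iA.
    have p0 : 0 < p by exact: lt_le_trans p1.
    have -> : e `^ p / #|`A|.+1%:R = d `^ p.
      by rewrite -powRrM mulVf ?powRr1 ?gt_eqF // ltW.
    by apply: ge0_ler_powR; rewrite ?nnegrE ?normc_ge0 ?(ltW p0) ?(ltW d0) // ltW // yA.
  rewrite big_const_seq count_predT iter_addr_0 -[leLHS]mulr_natr -mulrA ler_piMr ?powR_ge0 //.
  by rewrite ler_pdivrMl // mulr1 ler_nat cardfE.
have lfin : (lp_sum p l < +oo)%E.
  have [x xA] := filter_ex (bnd 1 ltr01).
  have finxl := lp_sum_fin xA.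
  have [finlx _] := lp_sumZ_norm p1 (-1) finxl.
  have [+ _] := lp_sumD_norm p1 finlx (lp_valP x).
  by congr (lp_sum p _ < +oo)%E; apply/funext => n; rewrite mulN1r opprB subrK.
pose L : lp := Lp (lp_funP lfin).
apply/cvg_ex; exists L; apply/cvg_ballP => e e0.
have [r re] : exists r : R, e = r%:C.
  by exists (complex.Re e); rewrite RRe_real // gtr0_real.
have r0 : 0 < r by rewrite -ltcR -re.
have r30 : 0 < r / 3 by rewrite divr_gt0.
rewrite near_simpl; apply: filterS (bnd _ r30) => x xA; rewrite re.
apply: ball_sym; apply/lp_ballE; apply: (@le_lt_trans _ _ (r / 3 + r / 3)); last by lra.
by apply: (lp_normP p1 _ (lp_valP (x - L))).2; [rewrite addr_ge0 // ltW|exact: xA].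
Qed.

HB.instance Definition _ := Uniform_isComplete.Build lp lp_complete.

Lemma lp_sum_delta (k : int) :
  (lp_sum p (fun n : int => (n == k)%:R : R[i])%R < +oo)%E.
Proof.
apply: (@lp_sum_fin _ _ _ 1) => A.
have [kA|kA] := boolP (k \in A).
  rewrite (big_fsetD1 k) //= eqxx normc1 powR1 big_seq big1 ?addr0 // => i.
  rewrite !inE => /andP[/negPf -> _].
  by rewrite normc0 powR0 ?gt_eqF // (lt_le_trans _ p1).
rewrite big_seq big1 // => i iA.
have /negPf -> : i != k by apply: contraNneq kA => <-.
by rewrite normc0 powR0 ?gt_eqF // (lt_le_trans _ p1).
Qed.

Definition lp_basis (k : int) : lp := Lp (lp_funP (lp_sum_delta k)).

Lemma lp_sum_shift (x : lp) : lp_sum p (fun n => x (n + 1)) = lp_sum p x.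
Proof.
rewrite /lp_sum [RHS](@reindex_esum R int int setT setT (fun n : int => n + 1)) //.
split=> // [m n _ _ /addIr //|n _].
by exists (n - 1); rewrite //= subrK.
Qed.

Lemma lp_sum_shift_fin (x : lp) : (lp_sum p (fun n => x (n + 1)%R) < +oo)%E.
Proof. by rewrite lp_sum_shift lp_valP. Qed.

(* (x_n)_n |-> (x_{n+1})_n : lp_shift_basis and lp_shift_continuous show that a
   bounded operator mapping each e_n to e_{n-1} exists. *)
Definition lp_shift (x : lp) : lp := Lp (lp_funP (lp_sum_shift_fin x)).

Fact lp_shift_is_linear : linear lp_shift.
Proof. by move=> a x y; exact/val_inj. Qed.

HB.instance Definition _ :=
  GRing.isLinear.Build R[i] lp lp *:%R lp_shift lp_shift_is_linear.

Lemma lp_shift_basis (n : int) : lp_shift (lp_basis n) = lp_basis (n - 1).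
Proof.
by apply/val_inj/funext => m /=; rewrite eq_sym -subr_eq eq_sym.
Qed.

Lemma lp_shift_norm (x : lp) : `|lp_shift x| = `|x|.
Proof. by rewrite !lp_normE /lp_norm lp_sum_shift. Qed.

Lemma lp_shift_continuous : continuous lp_shift.
Proof.
apply: bounded_linear_continuous; apply/bounded_funP => r.
by exists r => x; rewrite lp_shift_norm.
Qed.

End lp_space.

Arguments lp {R p} p1.
Arguments lp_basis {R p} p1 k.

Section weak_topology.
Context {K : numFieldType}.

(* E with the coarsest topology making all the functionals of its topological
   dual continuous. *)
Definition weak_space (E : normedModType K) : Type :=
  sup_topology (fun f : {f : {linear E -> K^o} | continuous f} =>
    Topological.on (initial_topology (sval f : E -> K^o))).

HB.instance Definition _ (E : normedModType K) := Topological.on (weak_space E).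

Lemma cvg_weakP (E : normedModType K) (F : set_system E) (x : E) : Filter F ->
  F --> (x : weak_space E) <->
  forall f : {linear E -> K^o}, continuous f -> f @ F --> f x.
Proof.
move=> FF; split=> [/cvg_sup Fx f fc A fxA|Fx].
  by apply: (Fx (exist _ f fc)); exact: (@initial_continuous E K^o f x A fxA).
apply/cvg_sup => -[f fc] A [_ [[U Uop <-] Ufx] UA].
have : F (f @^-1` U) by apply: (Fx f fc); apply: open_nbhs_nbhs.
exact: filterS.
Qed.

Definition weakly_supercyclic (E : completeNormedModType K)
    (T : {linear E -> E}) : Prop :=
  exists x : E, dense
    ([set y | exists (n : nat) (c : K), y = c *: iter n T x]
      : set (weak_space E)).

End weak_topology.

(* Main.v *)
From HB Require Import structures.
Require Import Defs.
From mathcomp Require Import all_boot all_order all_algebra finmap.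
From mathcomp Require Import complex.
From mathcomp Require Import all_classical all_reals all_analysis.
From mathcomp Require Import lra ring zify.
Import Order.TTheory GRing.Theory Num.Theory.
Import numFieldNormedType.Exports.
Import Normc.
Set Implicit Arguments.
Unset Strict Implicit.
Unset Printing Implicit Defensive.
Local Open Scope classical_set_scope.
Local Open Scope ring_scope.
Local Open Scope complex_scope.

(** Both directions turn on whether a sequence can lie in l_p without lying in
    l_2, and both avoid the description of the dual of l_p.

    Case p <= 2.  Let x be any vector.  Its coordinates are square summable, so
    a_n = |x_n| + |x_(n+1)| is square summable too, and a plank-type theorem
    yields one continuous functional f with |f (B^n x)| >= a_n for every n >= 0
    (orbit_separating_functional).  Some y in the kernel of f has y_0 or y_1
    nonzero, say y_r; the weak neighbourhood of y on which |f| < |y_r| / 2 and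
    the r-th coordinate moves by less than |y_r| / 2 misses every c B^n x,
    because |f (c B^n x)| >= |c| |x_(n+r)| is at least the modulus of the r-th
    coordinate of c B^n x.

    To find f it is enough to find, for each N, a functional with bounded norm
    that works for n < N, and to take a limit along an ultrafilter
    (sequence_cluster_functional).  The case of finite N is a statement about a
    real Toeplitz matrix T with entries rho (x_(i0 - l + j)), where rho is the
    real or imaginary part and rho (x_i0) <> 0 (plank_matrix).  If the rows of T
    were nearly orthogonal, a signed combination of them would do, by Bang's
    maximization over signs.  In general the Gram matrix G = T T^t may be badly
    conditioned; replacing G by G / (1 + G) = 1 - 1 / (1 + G) makes the norm of
    the solution bounded by that of the data, and the only price is a lower
    bound on the diagonal of G / (1 + G), which follows from the nonzero
    diagonal of T and the square summability of its columns.

    Case p > 2.  Take the weights w_k = (k + 1)^(-1/2): they are in l_p, while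
    the sum of w_k^2 is the harmonic series.  Put x = sum_j w_j S^(2^j) y_j,
    where S is the inverse of B and y_j runs through a family of finitely
    supported vectors, each of them repeated along infinitely many j, whose
    multiples are norm dense (dense_blocks).  Then B^(2^k) x = w_k y_k + r_k,
    and w_k r_k is a combination of the w_k w_j S^(2^j - 2^k) y_j with j <> k.
    The differences 2^j - 2^k with j <> k are all distinct, so these vectors
    behave like multiples of distinct basis vectors: sums over k of
    theta_k w_k r_k with |theta_k| <= 1 are bounded in norm, uniformly in the
    finite set of indices k (remainder_sum_bounded).  Choosing the theta_k
    suitably, the sum of w_k |f (r_k)| is finite for each continuous functional
    f, that is, w_k^2 |f (w_k^-1 B^(2^k) x - y_k)| is summable.  Since the sum of
    w_k^2 diverges along the indices k with a given y_k = y, the vectors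
    w_k^-1 B^(2^k) x converge weakly to y along the filter of sets whose
    complement has a convergent harmonic sum, so y is in the weak closure of
    the projective orbit of x. *)

(** * A plank theorem for matrices with square summable columns *)

Section plank_matrix.
Context {R : realFieldType}.

Definition sqnorm n (u : 'rV[R]_n) : R := \sum_k u 0 k ^+ 2.

Lemma sqnormE n (u : 'rV[R]_n) : (u *m u^T) 0 0 = sqnorm u.
Proof. by rewrite mxE; apply: eq_bigr => k _; rewrite mxE expr2. Qed.

Lemma sqnorm_ge0 n (u : 'rV[R]_n) : 0 <= sqnorm u.
Proof. by apply: sumr_ge0 => k _; exact: sqr_ge0. Qed.

Lemma sqnorm_gt0 n (u : 'rV[R]_n) : u != 0 -> 0 < sqnorm u.
Proof.
move=> u0; rewrite lt_def sqnorm_ge0 andbT; apply: contra_neq u0 => /eqP.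
rewrite psumr_eq0 => [/allP u0|k _]; last exact: sqr_ge0.
apply/rowP => k; rewrite mxE; apply/eqP; rewrite -sqrf_eq0.
by apply: u0; rewrite mem_index_enum.
Qed.

Lemma cauchy_schwarz_sum (I : eqType) (s : seq I) (P : pred I) (u v : I -> R) :
  (\sum_(i <- s | P i) u i * v i) ^+ 2 <=
  (\sum_(i <- s | P i) u i ^+ 2) * (\sum_(i <- s | P i) v i ^+ 2).
Proof.
elim: s => [|i s IH]; first by rewrite !big_nil mul0r expr0n.
rewrite !big_cons; case: (P i) => //.
set a := \sum_(j <- s | P j) _ in IH *; set b := \sum_(j <- s | P j) _ in IH *.
set c := \sum_(j <- s | P j) _ in IH *.
have b0 : 0 <= b by apply: sumr_ge0 => j _; exact: sqr_ge0.
have c0 : 0 <= c by apply: sumr_ge0 => j _; exact: sqr_ge0.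
have : (2 * (u i * v i * a)) <= u i ^+ 2 * c + b * v i ^+ 2.
  have s0 : 0 <= u i ^+ 2 * c + b * v i ^+ 2.
    by apply: addr_ge0; apply: mulr_ge0; rewrite ?sqr_ge0.
  apply: le_trans (ler_norm _) _; rewrite -(@ler_pXn2r _ 2) ?nnegrE //.
  rewrite real_normK ?num_real //.
  apply: (@le_trans _ _ (4 * (u i ^+ 2 * v i ^+ 2) * (b * c))).
    rewrite [leLHS](_ : _ = 4 * (u i ^+ 2 * v i ^+ 2) * a ^+ 2); last by ring.
    by rewrite ler_wpM2l //; apply: mulr_ge0 => //; apply: mulr_ge0; exact: sqr_ge0.
  rewrite -subr_ge0 [X in 0 <= X](_ : _ = (u i ^+ 2 * c - b * v i ^+ 2) ^+ 2).
    exact: sqr_ge0.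
  by ring.
move=> h; rewrite [leLHS](_ : _ = u i ^+ 2 * v i ^+ 2 + 2 * (u i * v i * a) + a ^+ 2); last by ring.
rewrite [leRHS](_ : _ = u i ^+ 2 * v i ^+ 2 + (u i ^+ 2 * c + b * v i ^+ 2) + b * c); last by ring.
by rewrite lerD // lerD.
Qed.

(** Bang's argument: among the sign changes c of m, take one that maximizes the
    quadratic form of F.  Flipping the j-th sign does not increase the form,
    which bounds the j-th entry of c F from below. *)
Lemma bang_signs n (F : 'M[R]_n) (m : 'rV[R]_n) : F^T = F ->
    (forall j, 0 <= m 0 j) -> (forall j, 0 <= F j j) ->
  exists c : 'rV[R]_n, sqnorm c = sqnorm m /\
    forall j, m 0 j * F j j <= `|(c *m F) 0 j|.
Proof.
move=> Fsym m0 F0.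
pose c (e : {ffun 'I_n -> bool}) : 'rV[R]_n := \row_j ((-1) ^+ e j * m 0 j).
pose Q e := (c e *m F *m (c e)^T) 0 0.
pose e := [arg max_(e > [ffun=> false]) Q e]%O.
have Qmax e' : Q e' <= Q e by rewrite /e; case: arg_maxP => // i _; apply.
exists (c e); split.
  by apply: eq_bigr => k _; rewrite mxE exprMn sqrr_sign mul1r.
move=> j.
pose e' := [ffun k => if k == j then ~~ e k else e k].
pose d := (delta_mx 0 j : 'rV[R]_n).
have ce' : c e' = c e - (2 * c e 0 j) *: d.
  apply/rowP => k; rewrite !mxE ffunE eqxx /=.
  have [->|kj] := eqVneq k j; last by rewrite mulr0 subr0.
  rewrite signrN mulr1; move: ((-1) ^+ e j) (m 0 j) => a b; ring.
have := Qmax e'; rewrite /Q ce'.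
have -> : (c e - (2 * c e 0 j) *: d)^T = (c e)^T - (2 * c e 0 j) *: d^T.
  by rewrite linearB /= linearZ.
rewrite mulmxBr !mulmxBl.
have dF u : (d *m F *m u^T) 0 0 = (u *m F) 0 j.
  by rewrite -rowE mxE [RHS]mxE; apply: eq_bigr => k _; rewrite !mxE -{1}Fsym mxE mulrC.
have Fd (u : 'rV[R]_n) : (u *m F *m d^T) 0 0 = (u *m F) 0 j.
  by rewrite trmx_delta -colE mxE.
rewrite -!scalemxAl -!scalemxAr.
have E1 : (d *m F *m d^T) 0 0 = F j j by rewrite Fd -rowE mxE.
rewrite [X in X <= _](_ : _ = (c e *m F *m (c e)^T) 0 0 -
    4 * c e 0 j * (c e *m F) 0 j + 4 * (c e 0 j) ^+ 2 * F j j); last first.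
  have sE (a b x y : 'M[R]_1) (s : R) : (a - s *: b - (s *: x - s *: (s *: y))) 0 0 =
      a 0 0 - s * b 0 0 - (s * x 0 0 - s * (s * y 0 0)) by rewrite !mxE.
  rewrite sE dF Fd E1; ring.
move=> h.
have c2 : c e 0 j ^+ 2 = m 0 j ^+ 2 by rewrite mxE exprMn sqrr_sign mul1r.
have cn : `|c e 0 j| = m 0 j by rewrite mxE normrM normr_sign mul1r ger0_norm.
have h2 : m 0 j * (m 0 j * F j j) <= m 0 j * `|(c e *m F) 0 j|.
  rewrite -{3}cn -normrM; apply: le_trans (ler_norm _).
  by rewrite mulrA -expr2 -c2; lra.
have [mj0|mj0] := eqVneq (m 0 j) 0; first by rewrite mj0 mul0r normr_ge0.
by move: h2; rewrite ler_pM2l // lt_def mj0 m0.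
Qed.

(** The vector v solves a Tikhonov-regularized version of T v^t = c^t, where c is a
    suitable sign change of m: with G = T T^t, it is v = c (1 + G)^-1 T, so that
    T v^t = (c F)^t with F = 1 - (1 + G)^-1, and the norm of v is at most that of c
    whatever the conditioning of G.  [bang_signs] chooses c, and it remains to
    bound the diagonal of F from below.  An entry F_jj close to 0 would mean
    that the j-th row s of (1 + G)^-1 is close to the j-th unit vector while
    s T is close to 0; the j-th entry of s T prevents this, as it is s_j T_jj up
    to an error that the norm of the j-th column of T controls. *)
Theorem plank_matrix n (T : 'M[R]_n) (al L : R) (m : 'rV[R]_n) :
    (forall j, 0 <= m 0 j) -> (forall l, \sum_k T k l ^+ 2 <= L) -> 0 <= L ->
    (forall j, al <= T j j ^+ 2) -> 0 <= al ->
  exists v : 'rV[R]_n, sqnorm v <= sqnorm m /\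
    forall j, m 0 j * (al / (1 + L + al)) <= `|\sum_l T j l * v 0 l|.
Proof.
move=> m0 TL L0 Tal al0.
pose G := T *m T^T; pose A := 1%:M + G.
have Gsym : G^T = G by rewrite /G trmx_mul trmxK.
have Asym : A^T = A by rewrite /A linearD /= trmx1 Gsym.
have uGu (u : 'rV[R]_n) : (u *m G *m u^T) 0 0 = sqnorm (u *m T).
  by rewrite -sqnormE trmx_mul !mulmxA.
have uAu (u : 'rV[R]_n) : (u *m A *m u^T) 0 0 = sqnorm u + sqnorm (u *m T).
  by rewrite /A mulmxDr mulmx1 mulmxDl mxE uGu sqnormE.
have Au : A \in unitmx.
  rewrite -row_free_unit -kermx_eq0; apply/eqP/row_matrixP => i.
  set u := row i _; rewrite row0.
  have uA : u *m A = 0 by rewrite /u -row_mul mulmx_ker row0.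
  have := uAu u; rewrite uA mul0mx mxE => /esym/eqP h.
  apply/eqP; apply: contraLR isT => /sqnorm_gt0 u0; move: h.
  by rewrite gt_eqF // ltr_wpDr // sqnorm_ge0.
pose S := invmx A; pose F := 1%:M - S.
have Ssym : S^T = S by rewrite /S trmx_inv Asym.
have Fsym : F^T = F by rewrite /F linearB /= trmx1 Ssym.
have SA : S *m A = 1%:M by rewrite /S mulVmx.
have Fjj j : al / (1 + L + al) <= F j j.
  pose s := row j S.
  have sA : s *m A = delta_mx 0 j by rewrite /s -row_mul SA row1.
  have sE : s 0 j = sqnorm s + sqnorm (s *m T).
    by rewrite -uAu sA -rowE !mxE.
  have FE : F j j = 1 - s 0 j by rewrite !mxE eqxx.
  pose r2 := \sum_(k | k != j) s 0 k ^+ 2.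
  have r2E : sqnorm s = s 0 j ^+ 2 + r2 by rewrite /sqnorm (bigD1 j).
  pose t := \sum_(k | k != j) s 0 k * T k j.
  have tE : (s *m T) 0 j = s 0 j * T j j + t by rewrite mxE (bigD1 j).
  have t2 : t ^+ 2 <= r2 * L.
    apply: le_trans (cauchy_schwarz_sum _ _ _ _) _; rewrite ler_wpM2l //.
      by apply: sumr_ge0 => k _; exact: sqr_ge0.
    by apply: le_trans (TL j); rewrite [leRHS](bigD1 j) //= lerDr sqr_ge0.
  have w2 : (s *m T) 0 j ^+ 2 <= sqnorm (s *m T).
    by rewrite /sqnorm (bigD1 j) //= lerDl; apply: sumr_ge0 => k _; exact: sqr_ge0.
  have r20 : 0 <= r2 by apply: sumr_ge0 => k _; exact: sqr_ge0.
  have s0 : 0 < s 0 j.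
    rewrite sE ltr_wpDr ?sqnorm_ge0 // sqnorm_gt0 //; apply/eqP => s0.
    move: sA; rewrite s0 mul0mx => /rowP/(_ j); rewrite !mxE !eqxx => /esym/eqP.
    by rewrite oner_eq0.
  (* The j-th entry of s T is s_j T_jj + t, and t^2 <= r2 L by Cauchy-Schwarz. *)
  have key : s 0 j ^+ 2 * al <= (sqnorm (s *m T) + r2) * (1 + L).
    apply: (@le_trans _ _ ((s 0 j * T j j) ^+ 2)).
      by rewrite exprMn ler_wpM2l // sqr_ge0.
    rewrite (_ : s 0 j * T j j = (s *m T) 0 j - t); last by rewrite tE addrK.
    move: t2 w2; move: ((s *m T) 0 j) (sqnorm (s *m T)) => w W.
    move=> t2 wW.
    have W0 : 0 <= W by apply: le_trans wW; exact: sqr_ge0.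
    have [L00|Ln0] := eqVneq L 0.
      have /eqP -> : t == 0 by rewrite -sqrf_eq0 eq_le sqr_ge0 andbT -(mulr0 r2) -L00.
      by rewrite subr0 L00 addr0 mulr1; lra.
    have Lp : 0 < L by rewrite lt_def Ln0.
    rewrite -(@ler_pM2l _ L) //.
    have h1 : 0 <= (L * w + t) ^+ 2 by exact: sqr_ge0.
    have h2 : L * (1 + L) * w ^+ 2 <= L * (1 + L) * W.
      by rewrite ler_wpM2l // mulr_ge0 // addr_ge0.
    have h3 : (1 + L) * t ^+ 2 <= (1 + L) * (r2 * L) by rewrite ler_wpM2l // addr_ge0.
    have h4 : L * (1 + L) * w ^+ 2 + (1 + L) * t ^+ 2 = L * (w - t) ^+ 2 + (L * w + t) ^+ 2.
      by ring.
    have h5 : L * ((W + r2) * (1 + L)) = L * (1 + L) * W + (1 + L) * (r2 * L) by ring.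
    lra.
  have sW : sqnorm (s *m T) + r2 = s 0 j * (1 - s 0 j) by have := sE; rewrite r2E; lra.
  move: key; rewrite sW expr2 -!mulrA ler_pM2l // FE => key.
  rewrite ler_pdivrMr; last by rewrite ltr_wpDr // ltr_pwDl.
  have : s 0 j * al <= (1 - s 0 j) * (1 + L) by [].
  lra.
have F0 j : 0 <= F j j.
  by apply: le_trans (Fjj j); rewrite divr_ge0 // !addr_ge0.
have [c [cm cF]] := bang_signs Fsym m0 F0.
pose d := c *m S.
have dA : d *m A = c by rewrite /d -mulmxA SA mulmx1.
have dG : d *m G = c *m F.
  have h : c = d + d *m G by rewrite -dA /A mulmxDr mulmx1.
  by rewrite /F mulmxBr mulmx1 -/d {1}h addrAC subrr add0r.
exists (d *m T); split.
  have dGd : \sum_k (d *m G) 0 k * d 0 k = sqnorm (d *m T).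
    by rewrite -uGu mxE; apply: eq_bigr => k _; rewrite [d^T _ _]mxE.
  have -> : sqnorm m = sqnorm d + 2 * sqnorm (d *m T) + sqnorm (d *m G).
    rewrite -cm -dA /A mulmxDr mulmx1 -dGd /sqnorm mulr_sumr -!big_split /=.
    by apply: eq_bigr => k _; rewrite [(d + d *m G) 0 k]mxE; ring.
  by have := sqnorm_ge0 d; have := sqnorm_ge0 (d *m T); have := sqnorm_ge0 (d *m G); lra.
move=> j; apply: (@le_trans _ _ (m 0 j * F j j)); first by rewrite ler_wpM2l.
rewrite (_ : \sum_l _ = (c *m F) 0 j) ?cF // -dG /G mulmxA [RHS]mxE.
by apply: eq_bigr => l _; rewrite [T^T _ _]mxE mulrC.
Qed.

End plank_matrix.

(** * Norm, coordinates and finitely supported vectors of l_p *)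

Section lp_facts.
Context {R : realType} {p : R} (p1 : 1 <= p).
Notation E := (lp p1).
Notation N x := (lp_norm p (@lp_val R p p1 x)).

Let p0 : 0 < p. Proof. exact: lt_le_trans p1. Qed.

Lemma lp_normD (x y : E) : N (x + y) <= N x + N y.
Proof. by have := ler_normD x y; rewrite !lp_normE -rmorphD /= lecR. Qed.

Lemma lp_normZ (a : R[i]) (x : E) : N (a *: x) = normc a * N x.
Proof.
have := normrZ a x; rewrite !lp_normE (_ : `|a| = (normc a)%:C) // -rmorphM /=.
by case.
Qed.

Lemma lp_norm0 : N (0 : E) = 0.
Proof. by have := normr0 E; rewrite lp_normE => -[]. Qed.

Lemma lp_norm_sum (I : Type) (s : seq I) (P : pred I) (F : I -> E) :
  N (\sum_(i <- s | P i) F i) <= \sum_(i <- s | P i) N (F i).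
Proof.
elim/big_rec2: _ => [|i y x _ IH]; first by rewrite lp_norm0.
by apply: le_trans (lp_normD _ _) _; rewrite lerD2l.
Qed.

Lemma lp_norm_le (x : E) (M : R) : 0 <= M ->
  (forall A : {fset int}, \sum_(i <- A) normc (x i) `^ p <= M `^ p) -> N x <= M.
Proof. by move=> M0 /(lp_normP p1 M0 (lp_valP x)). Qed.

Lemma lp_sum_le_norm (x : E) (A : {fset int}) :
  \sum_(i <- A) normc (x i) `^ p <= N x `^ p.
Proof. by have /(lp_normP p1 (lp_norm_ge0 p x) (lp_valP x)) := lexx (N x). Qed.

Lemma continuous_lp_bound (f : {linear E -> R[i]^o}) : continuous f ->
  exists2 M : R, 0 < M & forall x : E, normc (f x) <= M * N x.
Proof.
move=> /linear_bounded_continuous/linear_boundedP[M0 [M0r fM]].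
pose M : R := complex.Re M0 + 1.
have M0E : M0 = (complex.Re M0)%:C by rewrite RRe_real.
have lt_M : M0 < M%:C by rewrite M0E ltcR /M ltrDl.
exists (Num.max M 1); first by rewrite lt_max ltr01 orbT.
move=> x; have := fM _ lt_M x; rewrite lp_normE.
rewrite (_ : `|f x| = (normc (f x))%:C) // -rmorphM /= lecR => /le_trans; apply.
by rewrite ler_wpM2r ?lp_norm_ge0 // le_max lexx.
Qed.

Lemma lp_bound_continuous (f : {linear E -> R[i]^o}) (M : R) : 0 <= M ->
  (forall x : E, normc (f x) <= M * N x) -> continuous f.
Proof.
move=> M0 fM; apply/linear_bounded_continuous/linear_boundedP.
exists M%:C; split; first by rewrite ger0_real // lecR.
move=> r Mr x; apply: (@le_trans _ _ (M%:C * `|x|)); last by rewrite ler_wpM2r // ltW.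
by rewrite lp_normE (_ : `|f x| = (normc (f x))%:C) // -rmorphM /= lecR.
Qed.

Definition lp_coord (i : int) (x : E) : R[i]^o := x i.

Fact lp_coord_is_linear i : linear (lp_coord i).
Proof. by []. Qed.

HB.instance Definition _ i :=
  GRing.isLinear.Build R[i] E R[i]^o *:%R (lp_coord i) (lp_coord_is_linear i).

Lemma lp_coord_continuous i : continuous (lp_coord i).
Proof.
apply: (@lp_bound_continuous _ 1) => // x; rewrite mul1r.
exact: (normc_le_lp_norm p1 i (lp_valP x)).
Qed.

Lemma lp_sumE (I : Type) (s : seq I) (P : pred I) (F : I -> E) (i : int) :
  (\sum_(j <- s | P j) F j) i = \sum_(j <- s | P j) (F j i).
Proof. exact: (linear_sum (lp_coord i)). Qed.

Lemma lp_scaleE (a : R[i]) (x : E) (i : int) : (a *: x) i = a * x i.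
Proof. by []. Qed.

Lemma lp_subE (x y : E) (i : int) : (x - y) i = x i - y i.
Proof. by []. Qed.

(** The enumeration 0, -1, 1, -2, 2, ... of the integers. *)
Definition int_of_rank (l : nat) : int := if odd l then Negz l./2 else Posz l./2.
Definition rank_of_int (i : int) : nat :=
  match i with Posz n => n.*2 | Negz n => n.*2.+1 end.

Lemma int_of_rankK : cancel int_of_rank rank_of_int.
Proof.
by move=> l; rewrite /int_of_rank; case: ifP => ol /=; rewrite -[RHS]odd_double_half ol.
Qed.

Lemma rank_of_intK : cancel rank_of_int int_of_rank.
Proof.
case=> n; rewrite /int_of_rank /rank_of_int /=; first by rewrite odd_double doubleK.
by rewrite odd_double /= uphalf_double.
Qed.

Lemma lp_basisE (k i : int) : lp_basis p1 k i = (i == k)%:R.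
Proof. by []. Qed.

Lemma lp_sum_basisE (x : E) (L : nat) (i : int) :
  (\sum_(0 <= l < L) x (int_of_rank l) *: lp_basis p1 (int_of_rank l)) i =
  if (rank_of_int i < L)%N then x i else 0.
Proof.
rewrite lp_sumE; under eq_bigr do rewrite lp_scaleE lp_basisE.
case: ifP => iL.
  rewrite (bigD1_seq (rank_of_int i)) ?mem_index_iota ?iota_uniq //=.
  rewrite big1 => [|l li]; rewrite ?rank_of_intK.
    by rewrite eqxx mulr1 addr0.
  rewrite (negPf (_ : i != _)) ?mulr0 //.
  by apply: contraNneq li => ->; rewrite int_of_rankK.
rewrite big_nat big1 // => l lL; rewrite (negPf (_ : i != _)) ?mulr0 //.
by apply: contraFneq iL => ->; rewrite int_of_rankK.
Qed.

(** A finite set A carries all of the p-th power sum of x up to e^p, and any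
    initial segment of the enumeration that contains A leaves out no more. *)
Lemma lp_approx (x : E) (e : R) : 0 < e -> exists L : nat,
  N (x - \sum_(0 <= l < L) x (int_of_rank l) *: lp_basis p1 (int_of_rank l)) <= e.
Proof.
move=> e0; have ep0 : 0 < e `^ p by exact: powR_gt0.
have [A xA] : exists A : {fset int},
    (lp_sum p x < (\sum_(i <- A) normc (x i) `^ p + e `^ p)%:E)%E.
  have xf : lp_sum p x \is a fin_num.
    by rewrite ge0_fin_numE ?lp_valP // lp_sum_ge0.
  apply/not_existsP => noA.
  have : (lp_sum p x <= (fine (lp_sum p x) - e `^ p)%:E)%E.
    apply/lp_sum_le => A; have /negP := noA A; rewrite -leNgt -(fineK xf) lee_fin.
    by rewrite lerBrDr.
  by rewrite -{1}(fineK xf) lee_fin; lra.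
exists (\max_(i <- A) (rank_of_int i).+1)%N; set L := (\max_(i <- A) _)%N.
apply: lp_norm_le; first exact: ltW.
move=> A'; set y := _ - _.
have yE i : y i = if (rank_of_int i < L)%N then 0 else x i.
  rewrite /y lp_subE lp_sum_basisE.
  by case: ifP => _; rewrite ?subrr ?subr0.
clearbody y.
pose A'' := (A' `\` A)%fset.
have LA i : i \in A -> (rank_of_int i < L)%N.
  by move=> iA; rewrite /L (big_rem i) //= leq_max leqnn.
have -> : \sum_(i <- A') normc (y i) `^ p = \sum_(i <- A'') normc (y i) `^ p.
  rewrite (big_fsetID _ (mem A)) /= big_seq big1 ?add0r.
    apply: eq_fbigl => i; rewrite !inE; case: (i \in A) => //=; by rewrite ?andbF ?andbT.
  move=> i; rewrite !inE => /andP[_ iA].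
  by rewrite yE LA // normc0 powR0 ?gt_eqF.
apply: (@le_trans _ _ (\sum_(i <- A'') normc (x i) `^ p)).
  apply: ler_sum => i _; rewrite yE; case: ifP => // _.
  by rewrite normc0 powR0 ?gt_eqF // powR_ge0.
have : \sum_(i <- (A' `|` A)%fset) normc (x i) `^ p <=
       \sum_(i <- A) normc (x i) `^ p + e `^ p.
  have /ltW/lp_sum_le := xA; exact.
rewrite (big_fsetID _ (mem A)) /=.
have -> : [fset i in (A' `|` A)%fset | i \in A]%fset = A.
  by apply/fsetP => i; rewrite !inE; case: (i \in A); rewrite ?orbT ?andbF.
have -> : [fset i in (A' `|` A)%fset | i \notin A]%fset = A''.
  by apply/fsetP => i; rewrite !inE; case: (i \in A); rewrite ?orbF ?andbF ?andbT.
by rewrite lerD2l.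
Qed.

End lp_facts.
Arguments lp_coord {R p} p1 i x.

(** * The orbits of the shift *)

Section shift_orbit.
Context {R : realType} {p : R} (p1 : 1 <= p).
Notation E := (lp p1).
Variable B : {linear E -> E}.
Hypothesis B_cont : continuous B.
Hypothesis B_basis : forall n : int, B (lp_basis p1 n) = lp_basis p1 (n - 1).

(** The hypotheses on B only determine it on the basis; both sides are
    continuous functionals of x, so that density of the finitely supported
    vectors extends the formula to all of l_p. *)
Lemma shift_coord (x : E) (i : int) : B x i = x (i + 1).
Proof.
pose f : {linear E -> R[i]^o} := lp_coord p1 i \o B.
have fc : continuous f.
  move=> y; apply: (@continuous_comp _ _ _ B (lp_coord p1 i)); first exact: B_cont.
  exact: lp_coord_continuous.
have [M M0 fM] := continuous_lp_bound fc.
have [M' M'0 gM] := continuous_lp_bound (@lp_coord_continuous _ _ p1 (i + 1)).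
apply/eqP; rewrite -subr_eq0; apply/eqP/eq0_normc/eqP.
rewrite eq_le normc_ge0 andbT; apply/ler_addgt0Pr => e e0; rewrite add0r.
have d0 : 0 < e / (M + M') by rewrite divr_gt0 ?addr_gt0.
have [L] := lp_approx x d0; set s := \sum_(_ <= _ < _) _ => Ls.
have fs : f s = lp_coord p1 (i + 1) s.
  rewrite /s !linear_sum; apply: eq_bigr => l _; rewrite !linearZ /= B_basis.
  by rewrite /lp_coord !lp_basisE [i == _]eq_sym subr_eq eq_sym.
have -> : B x i - x (i + 1) = f (x - s) - lp_coord p1 (i + 1) (x - s).
  by rewrite [f _]linearB [lp_coord _ _ (x - s)]linearB fs opprB addrA subrK.
apply: le_trans (le_normcD _ _) _; rewrite normcN.
apply: (@le_trans _ _ ((M + M') * lp_norm p (x - s)%R)).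
  by rewrite mulrDl; apply: lerD; [exact: fM|exact: gM].
by rewrite -ler_pdivlMl ?addr_gt0 // mulrC.
Qed.

Lemma iter_shift_coord n (x : E) (i : int) : iter n B x i = x (i + n%:Z).
Proof.
elim: n i => [|n IH] i /=; first by rewrite addr0.
by rewrite shift_coord IH -addrA -PoszD add1n.
Qed.

End shift_orbit.

(** * Cluster points of bounded sequences of functionals *)

Section cluster.
Context {R : realType}.

Lemma ultra_filter_map (S T : Type) (U : set_system S) (u : S -> T) :
  UltraFilter U -> UltraFilter (fmap u U).
Proof.
move=> UU; split; first exact: fmap_proper_filter.
move=> G GP UG; apply/seteqP; split=> // A GA.
have [//|UnA] := in_ultra_setVsetC (u @^-1` A) UU.
have [t [At nAt]] := filter_ex (filterI GA (UG (~` A) UnA)).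
by case: (nAt At).
Qed.

Lemma real_ultra_limit (U : set_system nat) (u : nat -> R) (M : R) :
  UltraFilter U -> (forall n, `|u n| <= M) -> exists l : R, u @ U --> l.
Proof.
move=> UU uM; have := @segment_compact R (- M) M.
rewrite compact_ultra => /(_ (u @ U) (ultra_filter_map u UU)) [].
  by apply: (@filterE _ U) => n /=; rewrite in_itv /= -ler_norml.
by move=> l [_ ul]; exists l.
Qed.

Lemma normc_ReIm (z : R[i]) : normc z <= `|complex.Re z| + `|complex.Im z|.
Proof.
case: z => a b /=; rewrite -(@ler_pXn2r _ 2) ?nnegrE ?sqrtr_ge0 ?addr_ge0 //.
rewrite sqr_sqrtr ?addr_ge0 ?sqr_ge0 // sqrrD !real_normK ?num_real //.
by rewrite lerD2r lerDl mulrn_wge0 // mulr_ge0.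
Qed.

Lemma Re_le_normc (z : R[i]) : `|complex.Re z| <= normc z.
Proof. by case: z => a b; rewrite -sqrtr_sqr ler_wsqrtr // lerDl sqr_ge0. Qed.

Lemma Im_le_normc (z : R[i]) : `|complex.Im z| <= normc z.
Proof. by case: z => a b; rewrite -sqrtr_sqr ler_wsqrtr // lerDr sqr_ge0. Qed.

Lemma complex_ultra_limit (U : set_system nat) (u : nat -> R[i]) (M : R) :
    UltraFilter U -> (forall n, normc (u n) <= M) ->
  exists l : R[i], forall e : R, 0 < e -> U [set n | normc (u n - l) < e].
Proof.
move=> UU uM.
have [a ua] := real_ultra_limit UU (fun n => le_trans (Re_le_normc _) (uM n)).
have [b ub] := real_ultra_limit UU (fun n => le_trans (Im_le_normc _) (uM n)).
exists (a +i* b) => e e0; have e20 : 0 < e / 2 by rewrite divr_gt0.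
move/cvgrPdist_lt/(_ _ e20) : ua => ua; move/cvgrPdist_lt/(_ _ e20) : ub => ub.
apply: filterS2 ua ub => n /= ua ub; apply: le_lt_trans (normc_ReIm _) _.
move: ua ub; case: (u n) => c d /= ua ub.
by rewrite (splitr e) ltrD // distrC.
Qed.

Context {V : normedModType R[i]} (N : V -> R).

(** A sequential form of the Banach-Alaoglu theorem: a pointwise limit along an
    ultrafilter of functionals with a common bound is again linear with the same
    bound, and inherits lower bounds that hold eventually.  The function N
    is meant to be the norm of V, read in R rather than in R[i]. *)
Lemma sequence_cluster_functional (f : nat -> V -> R[i]^o) (C : R) :
    (forall n, linear (f n)) -> (forall n y, normc (f n y) <= C * N y) ->
  exists F : {linear V -> R[i]^o}, (forall y, normc (F y) <= C * N y) /\
    forall y b, (\forall n \near \oo, b <= normc (f n y)) -> b <= normc (F y).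
Proof.
move=> flin fC.
have [U [UU ooU]] := ultraFilterLemma eventually_filter.
have FU : ProperFilter U by exact: ultra_proper.
have /choice[F FE] : forall y, exists l : R[i], forall e : R, 0 < e ->
    U [set n | normc (f n y - l) < e].
  by move=> y; apply: (complex_ultra_limit (M := C * N y)).
have uniqF y l : (forall e : R, 0 < e -> U [set n | normc (f n y - l) < e]) -> F y = l.
  move=> yl; apply/eqP; rewrite -subr_eq0; apply/eqP/eq0_normc/eqP.
  rewrite eq_le normc_ge0 andbT; apply/ler_addgt0Pr => e e0; rewrite add0r.
  have e20 : 0 < e / 2 by rewrite divr_gt0.
  have [n [/= h1 h2]] := filter_ex (filterI (FE y _ e20) (yl _ e20)).
  rewrite (_ : F y - l = (f n y - l) + (- (f n y - F y))); last by rewrite opprB [RHS]addrC subrKA.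
  apply: le_trans (le_normcD _ _) _; rewrite normcN (splitr e).
  by rewrite lerD // ltW.
have Flin : linear (F : V -> R[i]^o).
  move=> a x y; apply: uniqF => e e0.
  have na : 0 < normc a + 1 by rewrite ltr_wpDl ?normc_ge0.
  have e20 : 0 < e / 2 by rewrite divr_gt0.
  have e30 : 0 < e / 2 / (normc a + 1) by rewrite divr_gt0.
  apply: filterS2 (FE x _ e30) (FE y _ e20) => n /= hx hy.
  rewrite flin (_ : _ - _ = a * (f n x - F x) + (f n y - F y)); last first.
    by rewrite /GRing.scale /=; ring.
  apply: le_lt_trans (le_normcD _ _) _; rewrite normcM [ltRHS]splitr ltr_leD ?(ltW hy) //.
  apply: (@le_lt_trans _ _ ((normc a + 1) * normc (f n x - F x))).
    by rewrite ler_wpM2r ?normc_ge0 // lerDl.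
  by rewrite mulrC -ltr_pdivlMr.
pose FL : {linear V -> R[i]^o} := HB.pack F (GRing.isLinear.Build _ _ _ _ F Flin).
exists FL; split => y /=.
  apply/ler_addgt0Pr => e e0; have [n /= h] := filter_ex (FE y _ e0).
  rewrite -[F y](subrK (f n y)); apply: le_trans (le_normcD _ _) _.
  by rewrite -opprB normcN addrC lerD ?fC // ltW.
move=> b /ooU yb; apply/ler_addgt0Pr => e e0.
have [n /= [h1 h2]] := filter_ex (filterI yb (FE y _ e0)).
apply: le_trans h1 _; rewrite -[f n y](subrK (F y)); apply: le_trans (le_normcD _ _) _.
by rewrite addrC lerD2l ltW.
Qed.

End cluster.

(** * The case p <= 2: a functional that separates the orbit *)

Section small_exponent.
Context {R : realType} {p : R} (p1 : 1 <= p).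
Notation E := (lp p1).
Notation N x := (lp_norm p (@lp_val R p p1 x)).
Hypothesis p2 : p <= 2.

(** The inclusion of l_p in l_2 has norm 1: for t = |x_i| / |x| <= 1 one has
    t^2 <= t^p. *)
Lemma lp_sum_sqr_le (x : E) (s : seq int) : uniq s ->
  \sum_(i <- s) normc (x i) ^+ 2 <= N x ^+ 2.
Proof.
move=> us; have p0 : 0 < p by exact: lt_le_trans p1.
have le_xN i : normc (x i) <= N x by exact: (normc_le_lp_norm p1 i (lp_valP x)).
have [N0|N0] := eqVneq (N x) 0.
  rewrite N0 big1 ?expr0n // => i _; have := le_xN i; rewrite N0 => xi.
  by rewrite (_ : normc (x i) = 0) ?expr0n //; apply/eqP; rewrite eq_le xi normc_ge0.
have Ngt0 : 0 < N x by rewrite lt_def N0 lp_norm_ge0.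
have Np : 0 < N x `^ p by rewrite powR_gt0.
have pt i : normc (x i) ^+ 2 <= N x ^+ 2 / N x `^ p * normc (x i) `^ p.
  have [x0|x0] := eqVneq (normc (x i)) 0.
    by rewrite x0 expr0n /= mulr_ge0 ?powR_ge0 // divr_ge0 ?sqr_ge0 // ltW.
  have xgt0 : 0 < normc (x i) by rewrite lt_def x0 normc_ge0.
  rewrite mulrAC ler_pdivlMr //.
  pose t := normc (x i) / N x.
  have t0 : 0 < t by rewrite divr_gt0.
  have xE : normc (x i) = t * N x by rewrite /t divfK.
  rewrite xE exprMn powRM ?(ltW t0) ?(ltW Ngt0) //.
  rewrite [leRHS](_ : _ = t `^ p * (N x ^+ 2 * N x `^ p)); last by ring.
  rewrite -mulrA ler_wpM2r //; first by rewrite mulr_ge0 ?sqr_ge0 // ltW.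
  rewrite -powR_mulrn ?(ltW t0) //; apply: ger_powR => //.
  rewrite t0 /= ler_pdivrMr // mul1r; exact: le_xN.
apply: le_trans (ler_sum _ (fun i _ => pt i)) _; rewrite -mulr_sumr.
have -> : \sum_(i <- s) normc (x i) `^ p = \sum_(i <- [fset i in s]%fset) normc (x i) `^ p.
  apply: perm_big; apply: uniq_perm => //; first exact: fset_uniq.
  by move=> i; rewrite in_fset.
rewrite mulrAC ler_pdivrMr // ler_wpM2l ?sqr_ge0 //.
exact: lp_sum_le_norm.
Qed.

Lemma lp_sum_sqr_ord_le (x : E) n (g : nat -> int) : injective g ->
  \sum_(k < n) normc (x (g k)) ^+ 2 <= N x ^+ 2.
Proof.
move=> g_inj; rewrite -(big_map (fun k : 'I_n => g k) xpredT (fun i => normc (x i) ^+ 2)).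
apply: lp_sum_sqr_le; rewrite map_inj_uniq ?index_enum_uniq //.
by move=> j k /g_inj/val_inj.
Qed.

Variable B : {linear E -> E}.
Hypothesis B_cont : continuous B.
Hypothesis B_basis : forall n : int, B (lp_basis p1 n) = lp_basis p1 (n - 1).

(** The functionals f n are combinations of finitely many coordinates; their
    coefficients v_ n are real, so that rho, which stands for the real or the
    imaginary part, can be applied coordinate by coordinate.  The matrix with entries
    rho (x (i0 - l + j)) has the constant diagonal rho (x i0) <> 0, and its
    columns are parts of the square summable sequence rho (x _).  The right-hand
    side of [plank_matrix] loses the factor ka, which is compensated by
    dividing the data by it. *)
Lemma part_separating_functional (x : E) (i0 : int) (rho : {additive R[i] -> R}) :
    (forall z, `|rho z| <= normc z) ->
    (forall (r : R) z, rho (r%:C * z) = r * rho z) -> rho (x i0) != 0 ->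
  exists f : {linear E -> R[i]^o}, continuous f /\
    forall n : nat, normc (x n) + normc (x (n%:Z + 1)) <= normc (f (iter n B x)).
Proof.
move=> rho_le rhoZ rho0.
pose al := rho (x i0) ^+ 2; pose L := N x ^+ 2; pose ka := al / (1 + L + al).
have L0 : 0 <= L by exact: sqr_ge0.
have al0 : 0 < al by rewrite lt_def sqrf_eq0 rho0 sqr_ge0.
have ka0 : 0 < ka by rewrite divr_gt0 // ltr_wpDl // addr_ge0.
pose a (n : nat) : R := normc (x n) + normc (x (n%:Z + 1)).
have a0 n : 0 <= a n by rewrite addr_ge0 ?normc_ge0.
have rho_sqr z : rho z ^+ 2 <= normc z ^+ 2.
  by rewrite -(real_normK (num_real (rho z))) ler_pXn2r ?nnegrE ?normc_ge0.
pose Q := 4 * L / ka ^+ 2.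
have Q0 : 0 <= Q by rewrite divr_ge0 ?sqr_ge0 // mulr_ge0.
have vex n : exists v : 'rV[R]_n, sqnorm v <= Q /\
    forall j : 'I_n, a j <= `|\sum_(l < n) rho (x (i0 - l%:Z + j%:Z)) * v 0 l|.
  pose T : 'M[R]_n := \matrix_(j, l) rho (x (i0 - l%:Z + j%:Z)).
  pose m : 'rV[R]_n := \row_j (a j / ka).
  have [|||||v [vm vT]] := @plank_matrix R n T al L m.
  - by move=> j; rewrite mxE divr_ge0 // ltW.
  - move=> l; apply: le_trans (lp_sum_sqr_ord_le x n (g := fun k : nat => i0 - l%:Z + k%:Z) _).
      by apply: ler_sum => k _; rewrite mxE.
    by move=> j k /addrI[].
  - exact: L0.
  - by move=> j; rewrite mxE subrK.
  - exact: ltW.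
  exists v; split.
    apply: le_trans vm _; rewrite /sqnorm.
    apply: (@le_trans _ _ (\sum_(k < n) (2 / ka ^+ 2) *
        (normc (x k%:Z) ^+ 2 + normc (x (1 + k%:Z)) ^+ 2))).
      apply: ler_sum => k _; rewrite mxE exprMn exprVn [leRHS]mulrAC.
      rewrite ler_wpM2r ?invr_ge0 ?sqr_ge0 //.
      rewrite /a [1 + _]addrC; move: (normc _) (normc _) => u w.
      by have := sqr_ge0 (u - w); lra.
    rewrite -mulr_sumr big_split /=.
    have h1 : \sum_(k < n) normc (x k%:Z) ^+ 2 <= N x ^+ 2.
      by apply: (lp_sum_sqr_ord_le x n (g := Posz)) => j k [].
    have h2 : \sum_(k < n) normc (x (1 + k%:Z)) ^+ 2 <= N x ^+ 2.
      by apply: (lp_sum_sqr_ord_le x n (g := fun k : nat => 1 + k%:Z)) => j k /addrI[].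
    rewrite /Q [leRHS](_ : _ = 2 / ka ^+ 2 * (L + L)); last by ring.
    by rewrite ler_wpM2l ?divr_ge0 ?sqr_ge0 // lerD.
  move=> j; have := vT j; rewrite mxE -/ka divfK ?gt_eqF //.
  by under eq_bigr do rewrite mxE.
have /choice[v_ vP] : forall n, exists v : nat -> R, \sum_(l < n) v l ^+ 2 <= Q /\
    forall j : 'I_n, a j <= `|\sum_(l < n) rho (x (i0 - l%:Z + j%:Z)) * v l|.
  move=> [|n]; first by exists (fun=> 0); rewrite big_ord0; split => // -[].
  have [v [v1 v2]] := vex n.+1; exists (fun l => v 0 (inord l)); split.
    by under eq_bigr do rewrite inord_val.
  by move=> j; under eq_bigr do rewrite inord_val.
pose f n (y : E) : R[i]^o := \sum_(l < n) (v_ n l)%:C * y (i0 - l%:Z).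
have flin n : linear (f n).
  move=> c y z; rewrite /f scaler_sumr -big_split /=; apply: eq_bigr => l _.
  have distr (u w b d : R[i]) : u * (w * b + d) = w * (u * b) + u * d by ring.
  exact: distr.
have fC n y : normc (f n y) <= Num.sqrt Q * N y.
  have [vQ _] := vP n.
  apply: (@le_trans _ _ (\sum_(l < n) `|v_ n l| * normc (y (i0 - l%:Z)))).
    rewrite /f; elim/big_ind2: _ => [|u1 w1 u2 w2 h1 h2|l _]; first by rewrite normc0.
      by apply: le_trans (le_normcD _ _) _; exact: lerD.
    by rewrite normcM /= expr0n /= addr0 sqrtr_sqr.
  rewrite -(@ler_pXn2r _ 2) ?nnegrE ?mulr_ge0 ?sqrtr_ge0 ?lp_norm_ge0 //; last first.
    by apply: sumr_ge0 => l _; rewrite mulr_ge0 ?normc_ge0.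
  apply: le_trans (cauchy_schwarz_sum _ _ _ _) _.
  rewrite exprMn sqr_sqrtr //; apply: ler_pM.
  - by apply: sumr_ge0 => l _; exact: sqr_ge0.
  - by apply: sumr_ge0 => l _; exact: sqr_ge0.
  - by under eq_bigr do rewrite real_normK ?num_real //.
  - by apply: (lp_sum_sqr_ord_le y n (g := fun l : nat => i0 - l%:Z)) => j k /addrI/oppr_inj[].
have [F [FC FE]] := sequence_cluster_functional flin fC.
exists F; split; first exact: (lp_bound_continuous (sqrtr_ge0 Q)).
move=> n; apply: FE; near=> k.
have nk : (n < k)%N by near: k; exists n.+1.
have [_ /(_ (Ordinal nk)) /= h] := vP k.
apply: le_trans h _; apply: le_trans (rho_le _).
rewrite /f raddf_sum le_eqVlt; apply/orP; left; apply/eqP; congr `|_|.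
apply: eq_bigr => l _; rewrite rhoZ mulrC; congr (_ * rho _).
by rewrite (iter_shift_coord B_cont B_basis).
Unshelve. all: by end_near. Qed.

(** The sum of two consecutive coordinates, rather than one, leaves room in the
    span of e_0 and e_1 for a vector of the kernel of f with a nonzero
    coordinate that f dominates on the orbit of x. *)
Lemma orbit_separating_functional (x : E) :
  exists f : {linear E -> R[i]^o}, continuous f /\
    forall n : nat, normc (x n) + normc (x (n%:Z + 1)) <= normc (f (iter n B x)).
Proof.
have [x0|/existsNP[i0 xi0]] := pselect (forall i, x i = 0).
  exists (lp_coord p1 0); split; first exact: lp_coord_continuous.
  by move=> n; rewrite !x0 normc0 addr0 normc_ge0.
have [r0|r0] := eqVneq (complex.Re (x i0)) 0; last first.
  refine (@part_separating_functional x i0 (@complex.Re R : {additive R[i] -> R}) _ _ r0);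
    first exact: Re_le_normc.
  by move=> r [c d] /=; rewrite mul0r subr0.
apply: (@part_separating_functional x i0 (@complex.Im R : {additive R[i] -> R})) => //;
  first exact: Im_le_normc.
  by move=> r [c d] /=; rewrite mul0r addr0.
apply/eqP => i0'; apply: xi0; move: r0 i0'; case: (x i0) => c d /= -> ->.
by [].
Qed.

Lemma weak_continuous (V : normedModType R[i]) (f : {linear V -> R[i]^o}) :
  continuous f -> continuous (f : weak_space V -> R[i]^o).
Proof.
move=> fc y.
by apply: ((cvg_weakP y (nbhs_filter (y : weak_space V))).1 _ f fc).
Qed.

Lemma shift_not_weakly_supercyclic : ~ weakly_supercyclic B.
Proof.
move=> [x xd].
have [f [fc fx]] := orbit_separating_functional x.
have [y [r [fy yr orb_r]]] : exists (y : E) (r : int), [/\ f y = 0, y r != 0 &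
    forall n, normc (x (r + n%:Z)) <= normc (f (iter n B x))].
  pose e k : E := lp_basis p1 k.
  have o0 n : normc (x (0 + n%:Z)) <= normc (f (iter n B x)).
    by rewrite add0r; apply: le_trans (fx n); rewrite lerDl normc_ge0.
  have o1 n : normc (x (1 + n%:Z)) <= normc (f (iter n B x)).
    by rewrite addrC; apply: le_trans (fx n); rewrite lerDr normc_ge0.
  have [f0|f0] := eqVneq (f (e 0)) 0.
    by exists (e 0), 0; split=> //; rewrite lp_basisE eqxx oner_eq0.
  exists (f (e 1) *: e 0 - f (e 0) *: e 1), 1; split=> //.
    have comm (u w : R[i]) : u * w - w * u = 0 by rewrite mulrC subrr.
    by rewrite linearB ![f (_ *: _)]linearZ; exact: (comm (f (e 1)) (f (e 0))).
  by rewrite lp_subE !lp_scaleE !lp_basisE /= mulr0 mulr1 sub0r oppr_eq0.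
pose d := normc (y r) / 2.
have yr0 : 0 < normc (y r).
  by rewrite lt_def normc_ge0 andbT; apply: contra_neq yr; exact: eq0_normc.
have d0 : 0 < d by rewrite divr_gt0.
have dC0 : 0 < d%:C by rewrite ltcR.
pose O1 := (f : weak_space E -> R[i]^o) @^-1` (ball 0 d%:C).
pose O2 := (lp_coord p1 r : weak_space E -> R[i]^o) @^-1` (ball (y r : R[i]^o) d%:C).
have ballE (u w : R[i]^o) : ball u d%:C w <-> normc (u - w) < d.
  by rewrite -ball_normE /= -ltcR.
have [||z [[z1 z2] [n [c zE]]]] := xd (O1 `&` O2).
- exists y; split; rewrite /O1 /O2 /= ballE.
    by rewrite fy subrr normc0.
  by rewrite /lp_coord subrr normc0.
- apply: openI; apply: open_comp; try exact: ball_open.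
    by move=> z _; exact: weak_continuous.
  by move=> z _; apply: weak_continuous; exact: lp_coord_continuous.
have fz : f z = c * f (iter n B x) by rewrite zE linearZ.
have zr : z r = c * x (r + n%:Z).
  by rewrite zE lp_scaleE (iter_shift_coord B_cont B_basis).
have {}z1 : normc (c * f (iter n B x)) < d.
  by rewrite -fz -normcN -sub0r; apply/ballE.
have {}z2 : normc (y r - c * x (r + n%:Z)) < d by rewrite -zr; apply/ballE.
rewrite normcM in z1.
have h : normc (y r) <= normc (y r - c * x (r + n%:Z)) + normc (c * x (r + n%:Z)).
  by rewrite -{1}[y r](subrK (c * x (r + n%:Z))); exact: le_normcD.
rewrite normcM in h.
have h2 : normc c * normc (x (r + n%:Z)) <= normc c * normc (f (iter n B x)).
  by rewrite ler_wpM2l ?normc_ge0.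
have : normc (y r) < d + d.
  by apply: le_lt_trans h _; rewrite ltrD //; exact: le_lt_trans h2 z1.
by rewrite /d -splitr ltxx.
Qed.

End small_exponent.

(** * The case p > 2: weights in l_p with divergent sum of squares *)

Section weights.
Context {R : realType}.

Definition weight (k : nat) : R := k.+1%:R `^ (- 2^-1).

Lemma weight_gt0 k : 0 < weight k.
Proof. by rewrite powR_gt0. Qed.

Lemma weight_sqr k : weight k ^+ 2 = k.+1%:R^-1.
Proof.
rewrite -powR_mulrn ?powR_ge0 // -powRrM mulNr mulVf // powR_inv1 //.
Qed.

Lemma weight_le1 k : weight k <= 1.
Proof.
rewrite -(@ler_pXn2r _ 2) ?nnegrE ?(ltW (weight_gt0 k)) // weight_sqr expr1n.
by rewrite invf_le1 // ler1n.
Qed.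

Lemma geometric_sum_le (q : R) n : 0 <= q -> q < 1 ->
  \sum_(0 <= l < n) q ^+ l <= (1 - q)^-1.
Proof.
move=> q0 q1; have q10 : 0 < 1 - q by rewrite subr_gt0.
rewrite -[leRHS]mul1r ler_pdivlMr // big_mkord mulrC.
have -> : (1 - q) * \sum_(l < n) q ^+ l = 1 - q ^+ n.
  rewrite -[in RHS](expr1n _ n) subrXX; congr (_ * _).
  by apply: eq_bigr => i _; rewrite expr1n mul1r.
by rewrite gerBl exprn_ge0.
Qed.

(** Cauchy condensation: the 2^b terms of the b-th dyadic block are at most
    2^(-b p / 2) each, hence have a sum of at most q^b. *)
Lemma weight_powR_bounded (p : R) : 2 < p ->
  exists2 C : R, 0 <= C & forall n, \sum_(0 <= k < n) weight k `^ p <= C.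
Proof.
move=> p2; pose s := p / 2; pose q : R := 2 `^ (1 - s).
have s1 : 1 < s by rewrite /s ltr_pdivlMr // mul1r.
have q1 : q < 1.
  rewrite lt_neqAle powR_eq1 !negb_or; apply/andP; split.
    by apply/and3P; split; [rewrite gt_eqF // ltr1n|rewrite -leNgt|rewrite lt_eqF // subr_lt0].
  by rewrite -[leRHS](powRr0 2) ler_powR // ?ler1n // subr_le0 ltW.
exists (1 - q)^-1.
  by rewrite invr_ge0 subr_ge0 ltW.
have wE k : weight k `^ p = k.+1%:R `^ (- s).
  by rewrite /weight -powRrM mulNr mulrC.
have dyadic J : \sum_(0 <= k < (2 ^ J).-1) weight k `^ p <= \sum_(0 <= b < J) q ^+ b.
  elim: J => [|J IH]; first by rewrite expn0 !big_nil.
  have J0 : (0 < 2 ^ J)%N by rewrite expn_gt0.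
  rewrite big_nat_recr //= (big_cat_nat (n := (2 ^ J).-1)) //=; last first.
    by rewrite -!subn1 leq_sub2r // leq_exp2l.
  rewrite lerD //.
  apply: (@le_trans _ _ (\sum_((2 ^ J).-1 <= k < (2 ^ J.+1).-1) (2 ^ J)%:R `^ (- s))).
    rewrite !big_nat; apply: ler_sum => k /andP[Jk _]; rewrite wE !powRN.
    rewrite lef_pV2 ?posrE ?powR_gt0 ?ltr0n //.
    apply: ge0_ler_powR; rewrite ?nnegrE //; first by lra.
    by rewrite ler_nat -(prednK J0).
  rewrite sumr_const_nat.
  have -> : ((2 ^ J.+1).-1 - (2 ^ J).-1 = 2 ^ J)%N by rewrite expnS; lia.
  rewrite [leLHS](_ : _ = (2 ^ J)%:R * (2 ^ J)%:R `^ (- s)); last by rewrite mulr_natl.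
  rewrite /q -powR_mulrn ?powR_ge0 // -powRrM.
  rewrite -{1}[(2 ^ J)%:R]powRr1 // -powRD; last by rewrite pnatr_eq0 -lt0n J0 implybT.
  by rewrite natrX -powR_mulrn // -powRrM [J%:R * _]mulrC.
move=> n; apply: le_trans (geometric_sum_le n (powR_ge0 _ _) q1).
apply: le_trans (dyadic n).
have n2 : (n <= (2 ^ n).-1)%N by rewrite -ltnS prednK ?expn_gt0 // ltn_expl.
rewrite [leRHS](big_cat_nat (n := n)) //= lerDl; apply: sumr_ge0 => k _.
exact: powR_ge0.
Qed.

End weights.

(** * Combinations of translates of finitely supported vectors *)

Section translates.
Context {R : realType} {p : R} (p1 : 1 <= p).
Notation E := (lp p1).
Notation N x := (lp_norm p (@lp_val R p p1 x)).
Let p0 : 0 < p. Proof. exact: lt_le_trans p1. Qed.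

Lemma lp_norm_disjoint_sum (I : eqType) (s : seq I) (pos : I -> int)
    (a : I -> R[i]) (M : R) : 0 <= M -> uniq s ->
    {in s &, injective pos} ->
    \sum_(i <- s) normc (a i) `^ p <= M `^ p ->
  N (\sum_(i <- s) a i *: lp_basis p1 (pos i)) <= M.
Proof.
move=> M0 us pos_inj aM.
apply: lp_norm_le => // A; apply: le_trans aM.
have pt k : normc ((\sum_(i <- s) a i *: lp_basis p1 (pos i)) k) `^ p =
    \sum_(i <- s | pos i == k) normc (a i) `^ p.
  rewrite lp_sumE; under eq_bigr do rewrite lp_scaleE lp_basisE.
  have [/hasP[i is_ /eqP ik]|nk] := boolP (has (fun i => pos i == k) s).
    rewrite (bigD1_seq i) //= [RHS]big_mkcond (bigD1_seq i) //= ik !eqxx mulr1.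
    rewrite big_seq_cond big1 ?addr0 => [|j /andP[js ji]].
      rewrite big_seq_cond big1 ?addr0 // => j /andP[js ji].
      case: eqP => // jk; move: ji; rewrite (pos_inj j i) ?eqxx //.
      by rewrite jk ik.
    case: eqP => [jk|]; last by rewrite mulr0.
    by move: ji; rewrite (pos_inj j i) ?eqxx // -jk ik.
  rewrite big_seq big1 => [|i is_].
    rewrite normc0 powR0 ?gt_eqF // big_seq_cond big1 // => i /andP[is_ ik].
    by case/negP: nk; apply/hasP; exists i.
  case: eqP => [ik|]; last by rewrite mulr0.
  by case/negP: nk; apply/hasP; exists i => //; rewrite ik.
rewrite (eq_bigr _ (fun k _ => pt k)).
under eq_bigr do rewrite big_mkcond.
rewrite exchange_big /=; apply: ler_sum => i _.
rewrite -big_mkcond /= -big_filter.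
have : uniq [seq k <- A | pos i == k] by rewrite filter_uniq ?fset_uniq.
have : forall k, k \in [seq k <- A | pos i == k] -> k = pos i.
  by move=> k; rewrite mem_filter => /andP[/eqP].
case: [seq k <- A | pos i == k] => [|k [|k' u]] hk; rewrite ?big_nil ?big_seq1 ?powR_ge0 //.
have kk' : k = k'.
  by rewrite (hk k (mem_head _ _)) (hk k') // !inE eqxx orbT.
by rewrite /= kk' inE eqxx.
Qed.

(** The vector with coordinates c, listed in the order of [int_of_rank], and
    translated by n to the right. *)
Definition block (c : seq R[i]) (n : int) : E :=
  \sum_(0 <= l < size c) c`_l *: lp_basis p1 (int_of_rank l + n).

Lemma block_widen (c : seq R[i]) (n : int) L : (size c <= L)%N ->
  block c n = \sum_(0 <= l < L) c`_l *: lp_basis p1 (int_of_rank l + n).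
Proof.
move=> cL; rewrite [RHS](big_cat_nat (n := size c)) //= [X in _ = _ + X](_ : _ = 0) ?addr0 //.
by rewrite big_nat big1 // => l /andP[cl _]; rewrite nth_default // scale0r.
Qed.

Definition geometric_decay (c : seq R[i]) := forall l, normc c`_l <= 2^-1 ^+ l.

(** The translates may overlap, but for each rank l the translates of the l-th
    basis vector are distinct, so that their combination has norm at most
    M / 2^l; the geometric series gives the factor 2. *)
Lemma lp_norm_blocks (I : eqType) (s : seq I) (pos : I -> int)
    (a : I -> R[i]) (c : I -> seq R[i]) (M : R) : 0 <= M -> uniq s ->
    {in s &, injective pos} ->
    (forall i, geometric_decay (c i)) ->
    \sum_(i <- s) normc (a i) `^ p <= M `^ p ->
  N (\sum_(i <- s) a i *: block (c i) (pos i)) <= 2 * M.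
Proof.
move=> M0 us pos_inj cd aM; pose L := (\max_(i <- s) size (c i))%N.
have cL i : i \in s -> (size (c i) <= L)%N.
  by move=> iS; rewrite /L (big_rem i) //= leq_maxl.
have -> : \sum_(i <- s) a i *: block (c i) (pos i) =
    \sum_(0 <= l < L) \sum_(i <- s) (a i * (c i)`_l) *:
       lp_basis p1 (int_of_rank l + pos i).
  rewrite exchange_big /=; apply: eq_big_seq => i iS.
  rewrite (block_widen _ (cL i iS)) scaler_sumr.
  by apply: eq_bigr => l _; rewrite scalerA.
apply: le_trans (lp_norm_sum _ _ _) _.
apply: (@le_trans _ _ (\sum_(0 <= l < L) 2^-1 ^+ l * M)).
  apply: ler_sum => l _; apply: lp_norm_disjoint_sum => //.
  - by rewrite mulr_ge0 // exprn_ge0 // invr_ge0.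
  - by move=> i j iS jS /addrI; exact: pos_inj.
  rewrite powRM ?exprn_ge0 ?invr_ge0 //.
  apply: (@le_trans _ _ (\sum_(i <- s) (2^-1 ^+ l) `^ p * normc (a i) `^ p)).
    apply: ler_sum => i _; rewrite normcM powRM ?normc_ge0 // mulrC.
    rewrite ler_wpM2r ?powR_ge0 //.
    apply: (ge0_ler_powR (ltW p0) _ _ (cd i l)); rewrite nnegrE ?normc_ge0 //.
  by rewrite -mulr_sumr ler_wpM2l ?powR_ge0.
rewrite -mulr_suml ler_wpM2r //.
have h0 : 0 <= 2^-1 :> R by lra.
have h1 : 2^-1 < 1 :> R by lra.
apply: le_trans (geometric_sum_le _ h0 h1) _.
by rewrite -[leRHS]invrK lef_pV2 ?posrE; lra.
Qed.

End translates.

(** * A sequence of blocks with dense multiples *)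

Section targets.
Context {R : realType} {p : R} (p1 : 1 <= p).
Notation E := (lp p1).
Notation N x := (lp_norm p (@lp_val R p p1 x)).

Lemma lp_norm_basis (k : int) : N (lp_basis p1 k) <= 1.
Proof.
have := @lp_norm_disjoint_sum R p p1 int [:: k] id (fun=> 1) 1 ler01 isT.
rewrite !big_seq1 scale1r normc1 powR1; apply => //.
Qed.

Lemma normc_real (r : R) : 0 <= r -> normc r%:C = r.
Proof. by move=> r0; rewrite /= expr0n /= addr0 sqrtr_sqr ger0_norm. Qed.

Lemma gaussian_rational_approx (z : R[i]) (d : R) : 0 < d ->
  exists q : rat * rat, normc (z - (ratr q.1 +i* ratr q.2)) <= d.
Proof.
move=> d0; have near_rat (x : R) : exists q : rat, `|x - ratr q| <= d / 2.
  have /rat_in_itvoo[q] : x - d / 2 < x + d / 2 by lra.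
  rewrite in_itv /= => /andP[h1 h2]; exists q.
  by rewrite ler_norml; apply/andP; split; lra.
case: z => a b; have [qa ha] := near_rat a; have [qb hb] := near_rat b.
exists (qa, qb); apply: le_trans (normc_ReIm _) _.
by rewrite (splitr d); exact: lerD.
Qed.

Lemma lp_norm_distD (x y z : E) : N (x - z) <= N (x - y) + N (y - z).
Proof. by rewrite -[x - z](subrKA y); exact: lp_normD. Qed.

Lemma block_scale (a : R[i]) (c : seq R[i]) (n : int) :
  block p1 [seq a * z | z <- c] n = a *: block p1 c n.
Proof.
rewrite /block size_map scaler_sumr !big_nat; apply: eq_bigr => l /andP[_ lc].
by rewrite (nth_map 0) // scalerA.
Qed.

(** All finite lists of Gaussian rationals, each divided by a constant D that is
    large enough to force the geometric decay of its entries.  The division is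
    harmless because only multiples of the blocks matter. *)
Lemma dense_blocks : exists c : nat -> seq R[i], (forall t, geometric_decay (c t)) /\
  forall (y : E) (e : R), 0 < e -> exists t a, N (y - a *: block p1 (c t) 0) <= e.
Proof.
pose val (s : seq (rat * rat)) : seq R[i] := [seq ratr q.1 +i* ratr q.2 | q <- s].
pose D (s : seq R[i]) : R := 1 + \sum_(0 <= l < size s) 2 ^+ l * normc s`_l.
have D0 s : 0 < D s.
  by rewrite ltr_pwDl // sumr_ge0 // => l _; rewrite mulr_ge0 ?normc_ge0 ?exprn_ge0.
pose raw t := if @choice.unpickle (seq (rat * rat)) t is Some s then val s else [::].
exists (fun t => [seq (D (raw t))^-1%:C * z | z <- raw t]); split=> [t l|y e e0].
  have [lt_l|ge_l] := ltnP l (size (raw t)); last first.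
    rewrite [X in normc X](_ : _ = 0); last by apply: nth_default; rewrite size_map.
    by rewrite normc0 exprn_ge0 // invr_ge0.
  rewrite (nth_map 0) // normcM normc_real ?invr_ge0 ?(ltW (D0 _)) //.
  rewrite mulrC ler_pdivrMr // exprVn mulrC ler_pdivlMr ?exprn_gt0 // mulrC /D.
  rewrite (bigD1_seq l) ?mem_index_iota ?iota_uniq //= addrCA lerDl.
  by rewrite addr_ge0 // sumr_ge0 // => k _; rewrite mulr_ge0 ?normc_ge0 ?exprn_ge0.
have e20 : 0 < e / 2 by rewrite divr_gt0.
have [L yL] := lp_approx y e20.
have d0 : 0 < e / 2 / L.+1%:R by rewrite divr_gt0.
have /choice[g gP] : forall l : nat, exists q : rat * rat,
    normc (y (int_of_rank l) - (ratr q.1 +i* ratr q.2)) <= e / 2 / L.+1%:R.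
  by move=> l; exact: gaussian_rational_approx.
pose s := mkseq g L; exists (choice.pickle s), (D (val s))%:C.
have -> : raw (choice.pickle s) = val s by rewrite /raw choice.pickleK.
have DV : (D (val s))%:C * (D (val s))^-1%:C = 1 by rewrite -rmorphM /= divff ?gt_eqF.
rewrite block_scale scalerA DV scale1r.
have -> : block p1 (val s) 0 = \sum_(0 <= l < L)
    (ratr (g l).1 +i* ratr (g l).2) *: lp_basis p1 (int_of_rank l).
  rewrite /block size_map size_mkseq !big_nat; apply: eq_bigr => l /andP[_ lL].
  by rewrite addr0 (nth_map (0, 0)) ?size_mkseq // nth_mkseq.
apply: le_trans (lp_norm_distD _ _ _) _; rewrite (splitr e).
apply: (lerD yL).
rewrite -sumrB; apply: le_trans (lp_norm_sum _ _ _) _.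
apply: (@le_trans _ _ (\sum_(0 <= l < L) e / 2 / L.+1%:R)).
  apply: ler_sum => l _; rewrite -scalerBl lp_normZ -[leRHS]mulr1.
  by apply: ler_pM; rewrite ?normc_ge0 ?lp_norm_ge0 ?lp_norm_basis.
rewrite sumr_const_nat subn0 -[leLHS]mulr_natr -mulrA ler_piMr ?(ltW e20) //.
by rewrite ler_pdivrMl // mulr1 ler_nat.
Qed.

End targets.

(** * Differences of powers of 2, and sums over finite index sets *)

(** The powers of 2 form a Sidon set. *)
Lemma expn2_diff_inj (j k j' k' : nat) : j != k -> j' != k' ->
  (2 ^ j)%:Z - (2 ^ k)%:Z = (2 ^ j')%:Z - (2 ^ k')%:Z -> j = j' /\ k = k'.
Proof.
have dbl a b : (a < b)%N -> (2 * 2 ^ a <= 2 ^ b)%N.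
  by rewrite -expnS leq_exp2l.
have pos a : (0 < 2 ^ a)%N by rewrite expn_gt0.
have aux a b a' b' : a' != b' -> (a < a')%N -> (2 ^ a + 2 ^ b' = 2 ^ a' + 2 ^ b)%N -> False.
  move=> ab' aa' h; have := dbl _ _ aa'; have := pos a; have := pos b.
  have [lt_b'a'|lt_a'b'|e] := ltngtP b' a'.
  - have := dbl _ _ lt_b'a'; have [lt_b'a|lt_ab'|eb] := ltngtP b' a; last by rewrite eb in h *; lia.
      by have := dbl _ _ lt_b'a; lia.
    by have := dbl _ _ lt_ab'; lia.
  - have := dbl _ _ lt_a'b'; have [lt_bb'|lt_b'b|eb] := ltngtP b b'; last by rewrite eb in h *; lia.
      by have := dbl _ _ lt_bb'; lia.
    by have := dbl _ _ lt_b'b; lia.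
  - by rewrite e eqxx in ab'.
move=> jk jk' h.
have {}h : (2 ^ j + 2 ^ k' = 2 ^ j' + 2 ^ k)%N by lia.
have [lt_j|lt_j|jj] := ltngtP j j'.
- by case: (aux _ _ _ _ jk' lt_j h).
- by case: (aux _ _ _ _ jk lt_j (esym h)).
split=> //; move: h; rewrite jj => /addnI/eqP.
by rewrite eqn_exp2l // => /eqP.
Qed.

Lemma sum_uniq_le {R : numDomainType} (s : seq nat) (J : nat) (F : nat -> R) :
  uniq s -> (forall k, k \in s -> (k < J)%N) -> (forall k, 0 <= F k) ->
  \sum_(k <- s) F k <= \sum_(0 <= k < J) F k.
Proof.
move=> us sJ F0; rewrite [leRHS](bigID (mem s)) /= -[X in _ <= X + _]big_filter.
rewrite [X in _ <= X + _](perm_big s) /=; first by rewrite lerDl sumr_ge0.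
apply: uniq_perm => //; first by rewrite filter_uniq ?iota_uniq.
move=> k; rewrite mem_filter mem_index_iota /=.
by apply: andb_idr => /sJ.
Qed.

(** * The case p > 2: construction of a weakly supercyclic vector *)

Section large_exponent.
Context {R : realType} {p : R} (p1 : 1 <= p).
Notation E := (lp p1).
Notation N x := (lp_norm p (@lp_val R p p1 x)).
Hypothesis p2 : 2 < p.
Variable B : {linear E -> E}.
Hypothesis B_cont : continuous B.
Hypothesis B_basis : forall n : int, B (lp_basis p1 n) = lp_basis p1 (n - 1).

Let p0 : 0 < p. Proof. exact: lt_le_trans p1. Qed.

Lemma shift_norm (x : E) n : N (iter n B x) = N x.
Proof.
have BE (y : E) : B y = lp_shift y.
  by apply/val_inj/funext => i; exact: (shift_coord B_cont B_basis y i).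
have sN (y : E) : N (lp_shift y) = N y.
  by rewrite /lp_norm lp_sum_shift.
elim: n => [//|n IH].
by rewrite iterS BE sN; exact: IH.
Qed.

Lemma shift_block (c : seq R[i]) (m : int) n :
  iter n B (block p1 c m) = block p1 c (m - n%:Z).
Proof.
elim: n => [|n IH] /=; first by rewrite subr0.
rewrite IH /block linear_sum; apply: eq_bigr => l _.
by rewrite linearZ /= B_basis -!addrA -opprD -PoszD addn1.
Qed.

Lemma shiftB n (x y : E) : iter n B (x - y) = iter n B x - iter n B y.
Proof. by elim: n => //= n ->; rewrite linearB. Qed.

Lemma shiftZ n a (x : E) : iter n B (a *: x) = a *: iter n B x.
Proof. by elim: n => //= n ->; rewrite linearZ. Qed.

Lemma shift_sum n (I : Type) (s : seq I) (F : I -> E) :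
  iter n B (\sum_(i <- s) F i) = \sum_(i <- s) iter n B (F i).
Proof. by elim: n => //= n ->; rewrite linear_sum. Qed.

Variable c : nat -> seq R[i].
Hypothesis c_decay : forall t, geometric_decay (c t).

(** Each value t is taken on the progression of the k with k + 1 = 2^t (2 m + 1),
    which is dense enough for the sum of [weight k ^+ 2] to diverge on it. *)
Definition tag (k : nat) : nat := logn 2 k.+1.

Definition supercyclic_term (j : nat) : E := (weight j)%:C *: block p1 (c (tag j)) (2 ^ j)%:Z.

(** The distinct positions 2^j make the Cauchy criterion for the series follow
    from the one for the p-th powers of the weights. *)
Lemma supercyclic_series_cvg : cvgn (series supercyclic_term).
Proof.
have [C C0 wC] := @weight_powR_bounded R p p2.
have /cauchy_seriesP wc : cauchy (series (fun k => weight k `^ p : R^o) @ \oo).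
  apply: cvg_cauchy; apply: nondecreasing_is_cvgn.
    apply/nondecreasing_seqP => n.
    by rewrite /series /= big_nat_recr //= lerDl powR_ge0.
  by exists C => _ [n _ <-]; exact: wC.
apply: cauchy_cvg; apply/cauchy_seriesP => e e0.
have [r re] : exists r : R, e = r%:C.
  by exists (complex.Re e); rewrite RRe_real // gtr0_real.
have r0 : 0 < r by rewrite -ltcR -re.
have rp : 0 < (r / 3) `^ p by rewrite powR_gt0 // divr_gt0.
have := wc _ rp; apply: filterS => -[m n] /= h.
rewrite lp_normE re ltcR; apply: (@le_lt_trans _ _ (2 * (r / 3))); last by lra.
apply: lp_norm_blocks => //.
- by rewrite divr_ge0 // ltW.
- exact: iota_uniq.
- by move=> i j _ _ [] /eqP; rewrite eqn_exp2l // => /eqP.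
- apply: ltW; apply: le_lt_trans h; apply: le_trans (ler_norm _).
  by apply: ler_sum => k _; rewrite normc_real ?(ltW (weight_gt0 _)).
Qed.

Definition supercyclic_vector : E := limn (series supercyclic_term).

Lemma supercyclic_vector_approx (e : R) : 0 < e -> exists J0, forall J, (J0 <= J)%N ->
  N (supercyclic_vector - \sum_(0 <= j < J) supercyclic_term j) <= e.
Proof.
move=> e0; have /cvgrPdist_le := supercyclic_series_cvg.
have eC0 : 0 < e%:C by rewrite ltcR.
move=> /(_ _ eC0)[J0 _ h]; exists J0 => J JJ.
by have := h J JJ; rewrite /= lp_normE lecR.
Qed.

Definition remainder (k : nat) : E :=
  iter (2 ^ k) B supercyclic_vector - (weight k)%:C *: block p1 (c (tag k)) 0.

(** Replacing the vector by a partial sum xx of its series that has at least the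
    terms with index in s changes the left-hand side by at most e.  The diagonal
    terms k = j then cancel against the subtracted blocks, and the others are
    translates by the pairwise distinct 2^j - 2^k, with coefficients whose p-th
    powers have a sum of at most the square of that of the [weight k `^ p]. *)
Lemma remainder_sum_bounded : exists2 C : R, 0 <= C &
  forall (s : seq nat) (th : nat -> R[i]), uniq s -> (forall k, normc (th k) <= 1) ->
    N (\sum_(k <- s) (th k * (weight k)%:C) *: remainder k) <= C.
Proof.
have [C C0 wC] := @weight_powR_bounded R p p2.
pose M := (C * C) `^ p^-1.
have M0 : 0 <= M by exact: powR_ge0.
have MC : M `^ p = C * C by rewrite -powRrM mulVf ?gt_eqF // powRr1 // mulr_ge0.
exists (2 * M); first by rewrite mulr_ge0.
move=> s th us th1; apply/ler_addgt0Pr => e e0.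
pose a k : R[i] := th k * (weight k)%:C.
have w0 k : 0 <= weight k :> R by exact: ltW (weight_gt0 k).
have a1 k : normc (a k) <= weight k.
  by rewrite /a normcM normc_real // ler_piMl.
have d0 : 0 < e / (size s).+1%:R by rewrite divr_gt0.
have [J0 HJ0] := supercyclic_vector_approx d0.
pose J := maxn J0 (\max_(k <- s) k.+1).
have sJ k : k \in s -> (k < J)%N.
  by move=> ks; rewrite /J leq_max; apply/orP; right; rewrite (big_rem k) //= leq_maxl.
have xJ := HJ0 J (leq_maxl _ _); set xx := \sum_(0 <= j < J) supercyclic_term j in xJ.
pose idx := [seq kj <- [seq (k, j) | k <- s, j <- index_iota 0 J] | kj.1 != kj.2].
have uidx : uniq idx.
  by rewrite filter_uniq // allpairs_uniq ?iota_uniq // => -[? ?] [? ?].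
have remE : \sum_(k <- s) a k *: remainder k =
    \sum_(k <- s) a k *: iter (2 ^ k) B (supercyclic_vector - xx) +
    \sum_(kj <- idx) (a kj.1 * (weight kj.2)%:C) *:
        block p1 (c (tag kj.2)) ((2 ^ kj.2)%:Z - (2 ^ kj.1)%:Z).
  rewrite /idx big_filter [X in _ = _ + X]big_mkcond big_allpairs -big_split /=.
  apply: eq_big_seq => k ks.
  rewrite -big_mkcond /= shiftB /remainder scalerBr [in RHS]scalerBr -addrA; congr (_ + _).
  rewrite -scalerN; under eq_bigr do rewrite -scalerA; rewrite -scaler_sumr -scalerN -scalerDr.
  congr (_ *: _); rewrite /xx shift_sum (bigD1_seq k) ?mem_index_iota ?iota_uniq ?sJ //=.
  rewrite opprD -addrA [X in _ = _ + X](_ : _ = 0) ?addr0.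
    by rewrite /supercyclic_term shiftZ shift_block subrr.
  rewrite addrC; apply/eqP; rewrite subr_eq0; apply/eqP.
  by apply: eq_big => [j|j _]; rewrite 1?eq_sym // /supercyclic_term shiftZ shift_block.
rewrite remE addrC; apply: le_trans (lp_normD _ _) _; apply: lerD.
  apply: (@lp_norm_blocks R p p1 _ idx (fun kj => (2 ^ kj.2)%:Z - (2 ^ kj.1)%:Z)
    (fun kj => a kj.1 * (weight kj.2)%:C) (fun kj => c (tag kj.2))) => //.
    move=> [k j] [k' j']; rewrite !mem_filter /= => /andP[kj _] /andP[kj' _].
    by rewrite eq_sym in kj; rewrite eq_sym in kj'; move=> /(expn2_diff_inj kj kj')[-> ->].
  rewrite MC /idx big_filter.
  apply: (@le_trans _ _ (\sum_(kj <- [seq (k, j) | k <- s, j <- index_iota 0 J])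
      weight kj.1 `^ p * weight kj.2 `^ p)).
    rewrite big_mkcond; apply: ler_sum => -[k j] _ /=; case: ifP => _; last first.
      by rewrite mulr_ge0 ?powR_ge0.
    rewrite normcM (normc_real (w0 _)) powRM ?normc_ge0 //.
    rewrite ler_wpM2r ?powR_ge0 //.
    by apply: (ge0_ler_powR (ltW p0) _ _ (a1 k)); rewrite nnegrE ?normc_ge0.
  rewrite big_allpairs /=; under eq_bigr do rewrite -mulr_sumr.
  rewrite -mulr_suml; apply: ler_pM => //.
  - by apply: sumr_ge0 => k _; exact: powR_ge0.
  - by apply: sumr_ge0 => k _; exact: powR_ge0.
  apply: le_trans (wC J); apply: sum_uniq_le => // k; exact: powR_ge0.
apply: le_trans (lp_norm_sum _ _ _) _.
apply: (@le_trans _ _ (\sum_(k <- s) e / (size s).+1%:R)).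
  apply: ler_sum => k _; rewrite lp_normZ shift_norm -[leRHS]mul1r.
  apply: ler_pM; rewrite ?normc_ge0 ?lp_norm_ge0 //.
  exact: le_trans (a1 k) (weight_le1 k).
rewrite big_const_seq count_predT iter_addr_0 -[leLHS]mulr_natr -mulrA ler_piMr ?(ltW e0) //.
by rewrite ler_pdivrMl // mulr1 ler_nat.
Qed.

(** The factors th k turn the values f (remainder k) into their moduli. *)
Lemma remainder_functional_bounded (f : {linear E -> R[i]^o}) : continuous f ->
  exists2 C : R, 0 <= C &
    forall s : seq nat, uniq s -> \sum_(k <- s) weight k * normc (f (remainder k)) <= C.
Proof.
move=> /continuous_lp_bound[Mf Mf0 fM]; have [C C0 remC] := remainder_sum_bounded.
exists (Mf * C); first by rewrite mulr_ge0 // ltW.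
move=> s us; pose th k : R[i] := (normc (f (remainder k)))%:C / f (remainder k).
have th1 k : normc (th k) <= 1.
  rewrite /th normcM normc_real ?normc_ge0 // normcV.
  have [->|z0] := eqVneq (normc (f (remainder k))) 0; first by rewrite mul0r.
  by rewrite divff.
have thE k : th k * f (remainder k) = (normc (f (remainder k)))%:C.
  rewrite /th; have [->|z0] := eqVneq (f (remainder k)) 0; first by rewrite normc0 mulr0.
  by rewrite divfK.
have := remC s th us th1; rewrite -(ler_pM2l Mf0); apply: le_trans.
apply: le_trans (fM _); rewrite linear_sum.
rewrite (eq_bigr (fun k => (weight k * normc (f (remainder k)))%:C)); last first.
  move=> k _; rewrite linearZ /=.
  transitivity ((weight k)%:C * (th k * f (remainder k)) : R[i]).
    by rewrite /GRing.scale /=; ring.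
  by rewrite thE -rmorphM.
rewrite -rmorph_sum normc_real // sumr_ge0 // => k _.
by rewrite mulr_ge0 ?normc_ge0 // ltW // weight_gt0.
Qed.

(** The dual filter of the ideal of sets with convergent harmonic sum; it is
    proper because the harmonic series diverges. *)
Definition harmonic_filter : set_system nat := [set P | exists M : R,
  forall s : seq nat, uniq s -> (forall m, m \in s -> ~ P m) ->
    \sum_(m <- s) m.+1%:R^-1 <= M].

Lemma harmonic_filter_proper : ProperFilter harmonic_filter.
Proof.
split.
  move=> [M hM]; apply: (@dvg_harmonic R); apply: nondecreasing_is_cvgn.
    apply/nondecreasing_seqP => n.
    by rewrite /series /= big_nat_recr //= lerDl invr_ge0.
  by exists M => _ [n _ <-]; apply: hM => [|m _ []]; exact: iota_uniq.
split.
- exists 0 => -[|m s] _ h; first by rewrite big_nil.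
  by case: (h m (mem_head _ _)).
- move=> P Q [M hM] [M' hM']; exists (M + M') => s us sPQ.
  rewrite (bigID (fun m => `[< P m >])) /= addrC -[X in X + _]big_filter -[X in _ + X]big_filter.
  apply: lerD.
    apply: hM; first exact: filter_uniq.
    by move=> m; rewrite mem_filter => /andP[/asboolPn].
  apply: hM'; first exact: filter_uniq.
  move=> m; rewrite mem_filter => /andP[/asboolP Pm ms] Qm.
  by case: (sPQ m ms).
- move=> P Q PQ [M hM]; exists M => s us sQ; apply: hM => // m ms Pm.
  exact: (sQ m ms (PQ m Pm)).
Qed.

Definition tagged_index (t m : nat) : nat := (2 ^ t * m.*2.+1).-1.

Lemma tagged_indexS t m : (tagged_index t m).+1 = (2 ^ t * m.*2.+1)%N.
Proof. by rewrite prednK // muln_gt0 expn_gt0. Qed.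

Lemma tag_tagged_index t m : tag (tagged_index t m) = t.
Proof.
rewrite /tag tagged_indexS lognM ?expn_gt0 // pfactorK // logn_coprime ?addn0 //.
by rewrite coprime2n /= odd_double.
Qed.

Lemma tagged_index_inj t : injective (tagged_index t).
Proof.
move=> m n /(congr1 S); rewrite !tagged_indexS => /eqP.
by rewrite eqn_pmul2l ?expn_gt0 // => /eqP[] /double_inj.
Qed.

Lemma harmonic_le_weight t m :
  m.+1%:R^-1 <= 2 ^+ t.+1 * weight (tagged_index t m) ^+ 2 :> R.
Proof.
rewrite weight_sqr tagged_indexS -natrX ler_pdivlMr ?ltr0n ?muln_gt0 ?expn_gt0 //.
rewrite mulrC ler_pdivrMr // -natrM ler_nat expnS -mulnA mulnCA leq_mul2l.
by apply/orP; right; lia.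
Qed.

Definition scaled_orbit (t m : nat) : E :=
  (weight (tagged_index t m))^-1%:C *: iter (2 ^ tagged_index t m) B supercyclic_vector.

(** On the exceptional set, e * weight^2 is at most weight * |f (remainder)|,
    which is summable; on the indices with tag t, weight^2 is comparable to the
    harmonic series. *)
Lemma scaled_orbit_weak_cvg (t : nat) (f : {linear E -> R[i]^o}) (e : R) :
    continuous f -> 0 < e ->
  harmonic_filter [set m | normc (f (scaled_orbit t m) - f (block p1 (c t) 0)) < e].
Proof.
move=> fc e0; have [C C0 fC] := remainder_functional_bounded fc.
exists (2 ^+ t.+1 * (C / e)) => s us sP.
have us' : uniq [seq tagged_index t m | m <- s].
  by rewrite map_inj_uniq //; exact: tagged_index_inj.
apply: (@le_trans _ _ (2 ^+ t.+1 * \sum_(m <- s) weight (tagged_index t m) ^+ 2)).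
  by rewrite mulr_sumr; apply: ler_sum => m _; exact: harmonic_le_weight.
rewrite ler_wpM2l ?exprn_ge0 // ler_pdivlMr // mulr_suml.
have := fC _ us'; rewrite big_map; apply: le_trans.
rewrite big_seq [leRHS]big_seq; apply: ler_sum => m /sP /= /negP; rewrite -leNgt => h.
set k := tagged_index t m; have wk := @weight_gt0 R k.
have remE : f (remainder k) =
    (weight k)%:C * (f (scaled_orbit t m) - f (block p1 (c t) 0)).
  rewrite /remainder /scaled_orbit -/k tag_tagged_index -linearB.
  transitivity (f ((weight k)%:C *:
      ((weight k)^-1%:C *: iter (2 ^ k) B supercyclic_vector - block p1 (c t) 0))).
    by rewrite scalerBr scalerA -rmorphM /= divff ?gt_eqF // scale1r.
  by rewrite linearZ.
rewrite remE normcM normc_real ?(ltW wk) // mulrA -expr2.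
by rewrite ler_wpM2l ?sqr_ge0.
Qed.

(** A weakly open set is norm open, hence contains a multiple of some block,
    which is a weak limit of multiples of elements of the orbit. *)
Lemma shift_weakly_supercyclic_of_dense :
    (forall (y : E) (e : R), 0 < e -> exists t a, N (y - a *: block p1 (c t) 0) <= e) ->
  weakly_supercyclic B.
Proof.
move=> c_dense; exists supercyclic_vector => O [y Oy] Oopen.
have Onbhs : nbhs (y : E) (O : set E).
  have /(_ O) : nbhs (y : E) `=>` nbhs (y : weak_space E).
    by apply: ((cvg_weakP (y : E) (nbhs_filter (y : E))).2 _) => f fc; exact: (fc y).
  by apply; exact: open_nbhs_nbhs.
move: Onbhs => /nbhs_ballP[e e0 eO].
have [r re] : exists r : R, e = r%:C.
  by exists (complex.Re e); rewrite RRe_real // gtr0_real.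
have r0 : 0 < r by rewrite -ltcR -re.
have r20 : 0 < r / 2 by rewrite divr_gt0.
have [t [a ya]] := c_dense y _ r20.
have Oa : O (a *: block p1 (c t) 0).
  apply: eO; rewrite re; apply/lp_ballE; apply: le_lt_trans ya _; lra.
have HF := harmonic_filter_proper.
have : (fun m => a *: scaled_orbit t m) @ harmonic_filter -->
    (a *: block p1 (c t) 0 : weak_space E).
  apply/cvg_weakP => f fc; apply/cvg_ballP => d d0.
  have [q qd] : exists q : R, d = q%:C.
    by exists (complex.Re d); rewrite RRe_real // gtr0_real.
  have q0 : 0 < q by rewrite -ltcR -qd.
  have a0 : 0 < normc a + 1 by rewrite ltr_wpDl ?normc_ge0.
  have qa : 0 < q / (normc a + 1) by rewrite divr_gt0.
  have := scaled_orbit_weak_cvg t fc qa.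
  apply: filterS => m /= h; rewrite -ball_normE /= qd ltcR.
  have -> : normc (f (a *: block p1 (c t) 0) - f (a *: scaled_orbit t m)) =
      normc a * normc (f (scaled_orbit t m) - f (block p1 (c t) 0)).
    rewrite -normcN opprB -linearB -scalerBr -linearB -normcM.
    by congr normc; exact: linearZ.
  apply: (@le_lt_trans _ _ ((normc a + 1) * normc (f (scaled_orbit t m) - f (block p1 (c t) 0)))).
    by rewrite ler_wpM2r ?normc_ge0 // lerDl.
  by rewrite mulrC -ltr_pdivlMr.
move=> /(_ O (open_nbhs_nbhs (conj Oopen Oa))) OG.
have [m /= Om] := @filter_ex _ harmonic_filter HF _ OG.
exists (a *: scaled_orbit t m); split => //.
by exists (2 ^ tagged_index t m)%N, (a * (weight (tagged_index t m))^-1%:C); rewrite -scalerA.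
Qed.

End large_exponent.

Theorem theorem1p5 (R : realType) (p : R) (p1 : 1 <= p)
    (B : {linear lp p1 -> lp p1}) (B_bounded : continuous B)
    (B_basis : forall n : int, B (lp_basis p1 n) = lp_basis p1 (n - 1)) :
  weakly_supercyclic B <-> 2 < p.
Proof.
split=> [Bws|p2].
  rewrite ltNge; apply/negP => p2.
  exact: (shift_not_weakly_supercyclic p2 B_bounded B_basis Bws).
have [c [c_decay c_dense]] := dense_blocks p1.
exact: (shift_weakly_supercyclic_of_dense p2 B_bounded B_basis c_decay c_dense).
Qed.
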